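(* Let $m\ge2$ be an integer. Let $c_1:\mathbb{R}\to\mathbb{R}$ be an $\mathbb{R}$-$\mathbb{R}$ TS function with $S(c_1)$ non-empty, and write $S(c_1)=\bigsqcup_j I_{1,j}$, where $j$ ranges over $\{1,\dots,l\}$ for a positive integer $l$, over all positive integers, or over all integers, each $I_{1,j}$ is a closed connected non-empty set which is a one-point set or a copy of $D^1$, $\{t\ge0\}$, or $\mathbb{R}$, and the sets are indexed consecutively along the real line. Let $c_{1,j}$ denote the unique value of $c_1$ on $I_{1,j}$. Suppose that $|c_{1,j}-c_{1,j+1}|$ is always greater than a positive number $N_{{\rm P},c_1,c_2}$. Let $c_2(x):=c_1(x)+a$ with $0<a<N_{{\rm P},c_1,c_2}$. Then the Reeb space $R_{\pi_{m+1,1}|_{X_{m,c_1,c_2}}}$ is the Reeb graph, and its vertices are of degree $1$, $2$, or $3$. This is also the Reeb digraph, and each of its vertices where the function $\overline{\pi_{m+1,1}|_{X_{m,c_1,c_2}}}$ has a local extremum is of degree $1$.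
   Context: For a differentiable function $c$, $S(c)$ denotes its set of critical points. An $\mathbb{R}$-$\mathbb{R}$ TS function is a smooth function $c:\mathbb{R}\to\mathbb{R}$ whose critical set $S(c)$ is a disjoint union of finitely many (possibly none) or countably many sets each of which is a one-point set or a copy of $D^1=[-1,1]$, $\{t\ge0\}$, or $\mathbb{R}$. $\pi_{k_1,k_2}:\mathbb{R}^{k_1}\to\mathbb{R}^{k_2}$ is the projection to the first $k_2$ coordinates. For smooth $c_1<c_2$, $D_{c_1,c_2}:=\{(x_1,x_2)\in\mathbb{R}^2\mid c_1(x_2)<x_1<c_2(x_2)\}$, with closure $\overline{D_{c_1,c_2}}$ in $\mathbb{R}^2$, and $$X_{m,c_1,c_2}:=\Big\{(x_1,x_2,(y_j)_{j=1}^{m-1})\in\overline{D_{c_1,c_2}}\times\mathbb{R}^{m-1}\ \Big|\ (x_1-c_1(x_2))(c_2(x_2)-x_1)-\sum_{j=1}^{m-1}y_j^2=0\Big\},$$ an $m$-dimensional smooth submanifold without boundary of $\mathbb{R}^{m+1}$. For a continuous function $c:X\to\mathbb{R}$, a contour is a connected component of a level set $c^{-1}(q)$; it is critical (for differentiable $c$) if it contains a critical point of $c$. The Reeb space $R_c$ is the quotient space of $X$ identifying points in the same contour, with quotient map $q_c$, and $\bar c:R_c\to\mathbb{R}$ is the unique continuous function with $c=\bar c\circ q_c$. A graph is a connected, locally compact, locally finite $1$-dimensional CW complex whose $1$-cells are edges and $0$-cells are vertices, the closure of each edge being homeomorphic to $D^1$; a graph with ends is defined in the same way but the closure of an edge may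 be homeomorphic to $D^1$ or to a half-line. The degree of a vertex is the number of edges incident to it. $R_c$ is called the Reeb graph of $c$ if it is a graph (with ends) whose vertex set consists exactly of the points corresponding to critical contours of $c$. It is then made into the Reeb digraph: an edge $e$ incident to a vertex $v$ departs from (resp. enters) $v$ if the restriction of $\bar c$ to the closure of $e$ has its minimum (resp. maximum) at $v$.
   Formalization: For m=2 it is also assumed that no line {q}×R lies inside D_{c_1,c_2} (automatic when S(c_1) has at least two components); without this the claim fails, e.g. c_1=0, a=1, where the Reeb space is a circle whose two extremal vertices have degree 2. *)

(* Defs.v *)
From HB Require Import structures.
From mathcomp Require Import all_boot all_order all_algebra generic_quotient.
From mathcomp Require Import all_classical all_reals all_analysis.
Import Order.TTheory GRing.Theory Num.Theory.
Import numFieldNormedType.Exports.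

Set Implicit Arguments.
Unset Strict Implicit.
Unset Printing Implicit Defensive.

Local Open Scope classical_set_scope.
Local Open Scope ring_scope.

Definition homeomorphism (T U : topologicalType) (A : set T) (B : set U)
    (f : T -> U) (g : U -> T) : Prop :=
  [/\ {within A, continuous f}, {within B, continuous g},
      (forall x, A x -> B (f x) /\ g (f x) = x) &
      (forall y, B y -> A (g y) /\ f (g y) = y)].

Definition homeomorphic (T U : topologicalType) (A : set T) (B : set U) : Prop :=
  exists f g, homeomorphism A B f g.

Section RealFunctions.
Context {R : realType}.

Definition smooth (c : R -> R) : Prop := forall n x, derivable (c^`(n))%classic x 1.

Definition critical_set (c : R -> R) : set R := [set x | (c^`())%classic x = 0].

Definition ts_piece (A : set R) : Prop :=
  [\/ exists x, A = [set x],
      homeomorphic A `[(-1 : R), 1]%classic,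
      homeomorphic A `[(0 : R), +oo[%classic |
      homeomorphic A [set: R]].

(* [J] is an arbitrary set of naturals: finite (possibly empty) or infinite. *)
Definition ts_function (c : R -> R) : Prop :=
  smooth c /\
  exists (J : set nat) (I : nat -> set R),
    [/\ trivIset J I, forall j, J j -> ts_piece (I j) &
        critical_set c = \bigcup_(j in J) I j].

Definition index_range (J : set int) : Prop :=
  [\/ exists2 l : int, 1 <= l & J = [set j | 1 <= j <= l],
      J = [set j | 1 <= j] |
      J = [set: int]].

(* The orientation of the indexing is not fixed: the sets are listed in their
   order along the line from left to right, or from right to left. *)
Definition consecutive (J : set int) (I : int -> set R) : Prop :=
  (forall j k, J j -> J k -> j < k -> forall s t, I j s -> I k t -> s < t) \/
  (forall j k, J j -> J k -> j < k -> forall s t, I j s -> I k t -> t < s).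

Definition strip (c1 c2 : R -> R) : set (R * R) :=
  [set x | c1 x.2 < x.1 < c2 x.2].

End RealFunctions.

Section Hypersurface.
Context {R : realType} (m : nat).
Implicit Types p v : 'rV[R]_m.+1.

Definition coord1 p : R := p ord0 ord0.
Definition coord2 p : R := p ord0 (inord 1).

(* The coordinates [y_1, ..., y_(m-1)] are those with (0-based) index >= 2. *)
Definition hypersurface (c1 c2 : R -> R) : set 'rV[R]_m.+1 :=
  [set p | closure (strip c1 c2) (coord1 p, coord2 p) /\
    (coord1 p - c1 (coord2 p)) * (c2 (coord2 p) - coord1 p)
      - \sum_(i < m.+1 | (2 <= i)%N) p ord0 i ^+ 2 = 0].

(* Tangent vectors of a submanifold: velocities of the smooth curves in it. *)
Definition tangent (X : set 'rV[R]_m.+1) p v : Prop :=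
  exists g : R -> 'rV[R]_m.+1,
    [/\ forall i, smooth (fun t => g t ord0 i), forall t, X (g t), g 0 = p &
        forall i, ((fun t => g t ord0 i)^`())%classic 0 = v ord0 i].

Definition critical_on (X : set 'rV[R]_m.+1) (f : 'rV[R]_m.+1 -> R) :
    set 'rV[R]_m.+1 :=
  [set p | X p /\ forall v, tangent X p v -> 'd f p v = 0].

End Hypersurface.

Arguments coord1 {R m} p.
Arguments coord2 {R m} p.
Arguments hypersurface {R} m c1 c2.

Section Graphs.
Context {R : realType} {T : topologicalType}.
Implicit Types (V : set T) (E : set (set T)) (e : set T).

(* The closure of an edge is a copy of an interval or of a half-line, in which
   the edge is the open 1-cell obtained by deleting the end point(s). *)
Definition compact_edge e : Prop :=
  exists f g, homeomorphism `[(-1 : R), 1]%classic (closure e) f g /\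
    f @` `](-1), 1[%classic = e.

Definition half_open_edge e : Prop :=
  exists f g, homeomorphism `[(0 : R), +oo[%classic (closure e) f g /\
    f @` `]0, +oo[%classic = e.

(* [V] is the set of vertices (0-cells), [E] the set of open edges (1-cells).
   A graph is the case in which every edge is a [compact_edge]. *)
Record graph_with_ends V E : Prop := GraphWithEnds {
  graph_hausdorff : hausdorff_space T ;
  graph_connected : connected [set: T] ;
  graph_locally_compact : locally_compact [set: T] ;
  graph_dim1 : E !=set0 ;
  graph_cover : V `|` \bigcup_(e in E) e = [set: T] ;
  graph_edges_disjoint : trivIset E id ;
  graph_edge_vertex_disjoint : forall e, E e -> e `&` V = set0 ;
  graph_edge_boundary : forall e, E e -> closure e `\` e `<=` V ;
  graph_edge_type : forall e, E e -> compact_edge e \/ half_open_edge e ;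
  graph_cw_topology : forall A : set T,
    (forall e, E e -> closed (A `&` closure e)) -> closed A ;
  graph_locally_finite : forall x : T, exists2 U : set T, nbhs x U &
    finite_set (V `&` U) /\
    finite_set [set e | E e /\ closure e `&` U !=set0] }.

Definition incident e (v : T) : Prop := closure e v.

Definition has_degree E (v : T) (n : nat) : Prop :=
  ([set e | E e /\ incident e v] #= `I_n)%card.

Definition departs (h : T -> R) e (v : T) : Prop :=
  incident e v /\ forall x, closure e x -> h v <= h x.

Definition enters (h : T -> R) e (v : T) : Prop :=
  incident e v /\ forall x, closure e x -> h x <= h v.

(* The rule given by [departs] and [enters] orients every edge: at each of its
   vertices exactly one of the two holds, and an edge with two distinct vertices
   departs from one and enters the other. *)
Definition oriented_by (h : T -> R) V E : Prop :=
  forall e, E e ->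
    (forall v, V v -> incident e v ->
      (departs h e v /\ ~ enters h e v) \/ (enters h e v /\ ~ departs h e v)) /\
    (forall v w, V v -> V w -> incident e v -> incident e w -> v <> w ->
      (departs h e v <-> enters h e w)).

Definition local_extremum (h : T -> R) (z : T) : Prop :=
  (\forall w \near z, h w <= h z) \/ (\forall w \near z, h z <= h w).

End Graphs.

Section ReebSpace.
Context {R : realType} {T : topologicalType} (f : T -> R).

Definition contour (x : T) : set T :=
  connected_component (f @^-1` [set f x]) x.

Definition same_contour : rel T := fun x y => `[< contour x y >].

Lemma contour_val x y : contour x y -> f y = f x.
Proof. exact: connected_component_sub. Qed.

Lemma contour_sym x y : contour x y -> contour y x.
Proof.
move=> xy; rewrite /contour (contour_val xy).
exact: connected_component_sym.
Qed.

Lemma same_contour_equiv : equiv_class_of same_contour.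
Proof.
split=> [x|x y|y x z].
- by apply/asboolP; exact: connected_component_refl.
- by apply/asboolP/asboolP; exact: contour_sym.
- move=> /asboolP xy /asboolP yz; apply/asboolP.
  move: yz; rewrite /contour (contour_val xy).
  exact: connected_component_trans.
Qed.

Canonical same_contour_canonical := EquivRelPack same_contour_equiv.

Definition reeb_space : topologicalType :=
  quotient_topology {eq_quot same_contour}%qT.

Definition reeb_map (x : T) : reeb_space :=
  (\pi_({eq_quot same_contour}) x)%qT.

Definition reeb_fun (z : reeb_space) : R :=
  f (repr (z : {eq_quot same_contour}%qT)).

Lemma reeb_map_eqP x y : reeb_map x = reeb_map y <-> contour x y.
Proof.
split=> [/eqmodP /asboolP //|xy]; apply/eqmodP; exact/asboolP.
Qed.

Lemma reeb_funE x : reeb_fun (reeb_map x) = f x.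
Proof.
rewrite /reeb_fun /reeb_map; case: piP => y /eqmodP /asboolP.
by move/contour_val.
Qed.

(* A contour is critical if it meets the set [crit] of critical points. *)
Definition reeb_vertices (crit : set T) : set reeb_space :=
  [set z | exists2 x, crit x & reeb_map x = z].

Definition is_reeb_graph (crit : set T) (E : set (set reeb_space)) : Prop :=
  graph_with_ends (R := R) (reeb_vertices crit) E.

Definition is_reeb_digraph (crit : set T) (E : set (set reeb_space)) : Prop :=
  is_reeb_graph crit E /\ oriented_by reeb_fun (reeb_vertices crit) E.

End ReebSpace.

Arguments reeb_fun {R T} f z.
Arguments reeb_vertices {R T} f crit.
Arguments is_reeb_graph {R T} f crit E.
Arguments is_reeb_digraph {R T} f crit E.

(* Main.v *)
Require Import Defs.
From HB Require Import structures.
From mathcomp Require Import all_boot all_order all_algebra.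
From mathcomp Require Import all_classical all_reals all_analysis.
From mathcomp Require Import finmap lra ring.
Import Order.TTheory GRing.Theory Num.Theory.
Import numFieldNormedType.Exports.

Set Implicit Arguments.
Unset Strict Implicit.
Unset Printing Implicit Defensive.

Local Open Scope classical_set_scope.
Local Open Scope ring_scope.

(** The level set of [x1 = q] lies over [A_q = {t | c t <= q <= c t + a}], with
    spheres as fibres, and its components are the preimages of the components
    of [A_q].  (For m = 2 the fibres are pairs of points, which are joined over
    an end of the component of [A_q]; only a component without ends, a line
    inside the strip, fails.)  Hence the Reeb space is the quotient of the closed
    strip that collapses the components of its horizontal slices: a point is a
    level together with a closed interval [C] of the line.

    Let S be the critical set of c.  Over an interval C the function c varies by
    at most a, while its values on neighbouring components of S differ by more
    than a, so C meets at most one component of S.  If C meets the component P,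
    where c = v, then the level is in [v, v + a]; its two ends give the vertices
    and its interior gives one open edge per component of S.  The other edges
    consist of the intervals C inside one component of the complement of S, where
    c is strictly monotone and the level parametrizes the edge.  All edges are
    open, and a vertex over P is incident to the edge of P and to at most the two
    edges of the neighbouring gaps, which gives the degrees.  Near a vertex that
    is a local extremum the level stays in [v, v + a], and then C still contains
    P, so that no gap edge ends there. *)

(** * Edges given by monotone arcs *)

Section NearInequalities.
Context {R : realType} {T : topologicalType} (h : T -> R).
Hypothesis ch : continuous h.

Lemma near_lt z r : h z < r -> \forall w \near z, h w < r.
Proof. by move=> hz; apply: (cvgr_lt (h z)) => //; exact: ch. Qed.

Lemma near_gt z r : r < h z -> \forall w \near z, r < h w.
Proof. by move=> hz; apply: (cvgr_gt (h z)) => //; exact: ch. Qed.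

End NearInequalities.

Section ClosedCells.
Context {R : realType} {T : topologicalType}.
Implicit Types (h : T -> R) (e : set T) (D : set R).

Definition closed_cell D D0 : Prop :=
  (D = `[(-1 : R), 1]%classic /\ D0 = `](-1), 1[%classic) \/
  (D = `[(0 : R), +oo[%classic /\ D0 = `]0, +oo[%classic).

(** The parameter increases with the height [h], so one datum yields both the cell structure and the
    orientation. Edges along which [h] decreases are treated as arcs for [\- h]. *)
Definition arc_edge h e : Prop :=
  exists D D0 (phi : R -> T), [/\ closed_cell D D0, continuous phi,
    closure e = phi @` D, e = phi @` D0 &
    forall x y, D x -> D y -> x < y -> h (phi x) < h (phi y)].

Lemma closed_cell_convex D D0 x y z : closed_cell D D0 ->
  D x -> D z -> x <= y <= z -> D y.
Proof.
move=> [[-> _]|[-> _]]; rewrite /= !in_itv /=; first lra.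
by rewrite !andbT; lra.
Qed.

Lemma closed_cell_compact D D0 b : closed_cell D D0 ->
  compact (D `&` [set x | x <= b]).
Proof.
move=> DD0; have cD : closed D.
  by case: DD0 => [[-> _]|[-> _]]; apply: itv_closed_ends_closed.
have lD : D `<=` [set x | -1 <= x].
  by case: DD0 => [[-> _]|[-> _]] x /=; rewrite in_itv /= ?andbT; lra.
apply: (@subclosed_compact _ _ `[-1, b]%classic).
- by apply: closedI => //; exact: closed_le.
- exact: segment_compact.
- by move=> x [/lD /= x1 /= xb]; rewrite in_itv /= x1 xb.
Qed.

Lemma mono_img_inj h D (phi : R -> T) :
  (forall x y, D x -> D y -> x < y -> h (phi x) < h (phi y)) ->
  forall x y, D x -> D y -> h (phi x) = h (phi y) -> x = y.
Proof.
move=> mono x y Dx Dy; case: (ltgtP x y) => // xy hxy.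
  by have := mono _ _ Dx Dy xy; rewrite hxy ltxx.
by have := mono _ _ Dy Dx xy; rewrite hxy ltxx.
Qed.

(** The inverse is continuous because [h] detects the parameter: near [phi t] the height stays below
    [h (phi (t + eps))], which forces the parameter below [t + eps], and likewise from below. If
    [t + eps] is outside [D], convexity of [D] gives the bound at once. *)
Lemma arc_edge_homeomorphism h D D0 (phi : R -> T) : continuous h ->
  closed_cell D D0 -> continuous phi ->
  (forall x y, D x -> D y -> x < y -> h (phi x) < h (phi y)) ->
  exists g, homeomorphism D (phi @` D) phi g.
Proof.
move=> ch DD0 cphi mono; have inj := mono_img_inj mono.
pose g z : R := xget (0 : R) [set t | D t /\ phi t = z].
have gphi t : D t -> g (phi t) = t.
  move=> Dt; rewrite /g; case: xgetP => [x _ [Dx px]|/(_ t)].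
    by apply: inj => //; rewrite px.
  by move=> /= /not_andP[].
exists g; split.
- exact: continuous_subspaceT.
- apply/subspace_continuousP => _ [t Dt <-].
  rewrite /from_subspace gphi //.
  apply/cvgrPdist_lt => eps eps0; rewrite near_withinE.
  have up : \forall w \near phi t, (phi @` D) w -> g w < t + eps.
    have [Dte|nDte] := pselect (D (t + eps)).
      have lt_te : h (phi t) < h (phi (t + eps)) by apply: mono => //; lra.
      apply: filterS (near_lt ch lt_te) => w /= + [u Du uw]; rewrite -{}uw gphi //.
      move=> hu; rewrite ltNge; apply/negP => teu.
      have [eu|ltu] := eqVneq (t + eps) u; first by move: hu; rewrite eu ltxx.
      have {}ltu : t + eps < u by rewrite lt_neqAle ltu.
      by have := mono _ _ Dte Du ltu; lra.
    apply: nearW => _ [u Du <-]; rewrite gphi // ltNge; apply/negP => teu.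
    by apply: nDte; apply: (closed_cell_convex DD0 Dt Du); rewrite teu; lra.
  have lo : \forall w \near phi t, (phi @` D) w -> t - eps < g w.
    have [Dte|nDte] := pselect (D (t - eps)).
      have lt_te : h (phi (t - eps)) < h (phi t) by apply: mono => //; lra.
      apply: filterS (near_gt ch lt_te) => w /= + [u Du uw]; rewrite -{}uw gphi //.
      move=> hu; rewrite ltNge; apply/negP => teu.
      have [eu|ltu] := eqVneq u (t - eps); first by move: hu; rewrite eu ltxx.
      have {}ltu : u < t - eps by rewrite lt_neqAle ltu.
      by have := mono _ _ Du Dte ltu; lra.
    apply: nearW => _ [u Du <-]; rewrite gphi // ltNge; apply/negP => teu.
    by apply: nDte; apply: (closed_cell_convex DD0 Du Dt); rewrite teu; lra.
  apply: filterS2 up lo => w wup wlo pw.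
  by rewrite ltr_distlC wup // wlo.
- by move=> x Dx; split; [exists x|exact: gphi].
- by move=> _ [t Dt <-]; rewrite gphi.
Qed.

Lemma arc_edge_type h e : continuous h -> arc_edge h e ->
  compact_edge (R := R) e \/ half_open_edge (R := R) e.
Proof.
move=> ch [D [D0 [phi [DD0 cphi clE eE mono]]]].
have [g hg] := arc_edge_homeomorphism ch DD0 cphi mono.
by case: DD0 => -[DE D0E]; [left|right]; exists phi, g; rewrite clE -DE -D0E.
Qed.

(** Around [phi t] the compact set is the image of the parameters up to [t + 1]; the neighbourhood
    is cut out by the height [h (phi (t + 1))], if that parameter exists. *)
Lemma arc_edge_local_compact h e (z : T) : continuous h -> arc_edge h e ->
  exists U K : set T, [/\ nbhs z U, compact K & closure e `&` U `<=` K].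
Proof.
move=> ch [D [D0 [phi [DD0 cphi clE eE mono]]]].
have [|nez] := pselect (closure e z); last first.
  exists (~` closure e), set0; split.
  - apply: open_nbhs_nbhs; split => //.
    by apply: closed_openC; exact: closed_closure.
  - exact: compact0.
  - by move=> w [].
rewrite clE => -[t Dt <-].
set K := phi @` (D `&` [set x | x <= t + 1]); have cK : compact K.
  apply: continuous_compact; first exact: continuous_subspaceT.
  exact: closed_cell_compact DD0.
have [Dt1|nDt1] := pselect (D (t + 1)).
  exists (h @^-1` [set r | r < h (phi (t + 1))]), K; split; last 2 first.
  - exact: cK.
  - move=> _ [[u Du <-] /= hu]; exists u => //; split => //=.
    rewrite leNgt; apply/negP => tu; have := mono _ _ Dt1 Du tu; lra.
  - have lt_te : h (phi t) < h (phi (t + 1)) by apply: mono => //; lra.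
    exact: (near_lt ch lt_te).
exists setT, K; split; last 2 first.
- exact: cK.
- move=> _ [[u Du <-] _]; exists u => //; split => //=.
  rewrite leNgt; apply/negP => tu; apply: nDt1.
  by apply: (closed_cell_convex DD0 Dt Du); lra.
- exact: filterT.
Qed.

(** The orientation condition for a single edge, whose end points are taken to be the points of
    [closure e] outside [e]. The last clause keeps distinct end points at different heights. *)
Definition oriented_edge h e : Prop :=
  [/\ forall z, closure e z -> ~ e z -> departs h e z \/ enters h e z,
      forall z, ~ (departs h e z /\ enters h e z) &
      forall z w, closure e z -> closure e w -> h z = h w -> z = w].

Lemma departsN h e z : departs (\- h) e z <-> enters h e z.
Proof.
by split=> -[ez hz]; split=> // x /hz /=; rewrite lerN2.
Qed.

Lemma entersN h e z : enters (\- h) e z <-> departs h e z.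
Proof.
by split=> -[ez hz]; split=> // x /hz /=; rewrite lerN2.
Qed.

Lemma oriented_edgeN h e : oriented_edge (\- h) e -> oriented_edge h e.
Proof.
move=> [dv nde inj]; split=> [z ez nez|z [dz ez]|z w ez ew hzw].
- by have [/departsN|/entersN] := dv z ez nez; [right|left].
- by apply: (nde z); split; [exact/departsN|exact/entersN].
- by apply: inj => //=; rewrite hzw.
Qed.

(** An end of the closed cell is its least or its greatest parameter, so by monotonicity the edge
    departs from or enters its image. *)
Lemma arc_edge_oriented h e : arc_edge h e -> oriented_edge h e.
Proof.
move=> [D [D0 [phi [DD0 cphi clE eE mono]]]]; have inj := mono_img_inj mono.
split.
- rewrite {1}clE => _ [t Dt <-] nt.
  have {}nt : ~ D0 t by move=> D0t; apply: nt; rewrite eE; exists t.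
  have [tmin|tmax] : (forall x, D x -> t <= x) \/ (forall x, D x -> x <= t).
    case: DD0 Dt nt => -[-> ->] /=; rewrite !in_itv /= ?andbT => Dt nt.
      have [t1|t1] : t = -1 \/ t = 1.
        have [->|t1] := eqVneq t (-1); first by left.
        right; apply/eqP; rewrite eq_le; case/andP: Dt => a1 ->/=.
        rewrite leNgt; apply/negP => tl; apply: nt; rewrite tl andbT.
        by rewrite lt_neqAle eq_sym t1.
      + by left=> x; rewrite in_itv /= t1 => /andP[].
      + by right=> x; rewrite in_itv /= t1 => /andP[].
    left=> x; rewrite in_itv /= andbT; move/negP: nt; lra.
  + left; split; first by rewrite /incident clE; exists t.
    rewrite clE => _ [x Dx <-]; have := tmin x Dx.
    by rewrite le_eqVlt => /predU1P[->//|/(mono _ _ Dt Dx)/ltW].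
  + right; split; first by rewrite /incident clE; exists t.
    rewrite clE => _ [x Dx <-]; have := tmax x Dx.
    by rewrite le_eqVlt => /predU1P[->//|/(mono _ _ Dx Dt)/ltW].
- move=> z [[ez dz] [_ ez']].
  have [x [y [Dx Dy xy]]] : exists x y, [/\ D x, D y & x < y].
    case: DD0 => -[-> _]; first by exists (-1), 1; split;
      rewrite /= ?in_itv /= ?lexx ?ltr01 //; lra.
    by exists 0, 1; split; rewrite /= ?in_itv /= ?lexx ?ler01 ?ltr01.
  have ex : closure e (phi x) by rewrite clE; exists x.
  have ey : closure e (phi y) by rewrite clE; exists y.
  have := mono _ _ Dx Dy xy; have := dz _ ex; have := ez' _ ey; lra.
- by rewrite clE => _ _ [x Dx <-] [y Dy <-] /inj ->.
Qed.

Lemma oriented_by_edges h (V : set T) (E : set (set T)) :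
  (forall e, E e -> e `&` V = set0) -> (forall e, E e -> oriented_edge h e) ->
  oriented_by h V E.
Proof.
move=> eV oE e Ee; have [dv nde inj] := oE e Ee.
have nV z : V z -> ~ e z by move=> Vz ez; have : (e `&` V) z by []; rewrite eV.
split=> [z Vz ez|z w Vz Vw ez ew zw].
  by have [dz|ez'] := dv z ez (nV _ Vz); [left|right]; split => // ?;
    apply: (nde z).
have ne : h z <> h w by move/(inj _ _ ez ew).
split=> [dz|ew'].
  have [dw|//] := dv w ew (nV _ Vw); exfalso; apply: ne; apply/eqP.
  by rewrite eq_le (dz.2 _ ew) (dw.2 _ ez).
have [//|ez'] := dv z ez (nV _ Vz); exfalso; apply: ne; apply/eqP.
by rewrite eq_le (ez'.2 _ ew) (ew'.2 _ ez).
Qed.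

End ClosedCells.

(** * Spaces covered by a locally finite family of closures *)

Section LocallyFiniteFamily.
Context {T : topologicalType} (E : set (set T)).
Hypothesis coverE : \bigcup_(e in E) closure e = [set: T].
Hypothesis locfinE : forall x : T, exists2 U : set T, nbhs x U &
  finite_set [set e | E e /\ closure e `&` U !=set0].

(** Near a given point [A] coincides with a finite union of the closed sets [A] intersected with
    [closure e]. *)
Lemma locally_finite_closed (A : set T) :
  (forall e, E e -> closed (A `&` closure e)) -> closed A.
Proof.
move=> cA z clAz; have [U Uz finU] := locfinE z.
set F := [set e | _] in finU.
have cB : closed (\bigcup_(e in F) (A `&` closure e)).
  by apply: closed_bigcup => // e [Ee _]; exact: cA.
suff : (\bigcup_(e in F) (A `&` closure e)) z by move=> [e _ []].
apply: cB => W Wz; have [w [Aw [Ww Uw]]] := clAz _ (filterI Wz Uz).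
have : [set: T] w by []; rewrite -coverE => -[e Ee ew].
by exists w; split => //; exists e; split => //; exists w.
Qed.

Lemma locally_finite_locally_compact : hausdorff_space T ->
  (forall e (z : T), E e ->
    exists U K : set T, [/\ nbhs z U, compact K & closure e `&` U `<=` K]) ->
  locally_compact [set: T].
Proof.
move=> hT lcE z _; have [U Uz finU] := locfinE z.
set F := [set e | _] in finU.
have /choice[UK UKP] (e : set T) : exists UK : set T * set T,
    E e -> [/\ nbhs z UK.1, compact UK.2 & closure e `&` UK.1 `<=` UK.2].
  (* Outside [E] the choice function takes a dummy pair. *)
  have [Ee|nEe] := pselect (E e); last by exists (set0, set0).
  by have [U' [K ?]] := lcE e z Ee; exists (U', K).
have cK : compact (\bigcup_(e in F) (UK e).2).
  rewrite -bigsetU_fset_set // big_seq_cond; apply: bigsetU_compact => e.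
  rewrite andbT in_fset_set // => /set_mem[Ee _].
  by have [] := UKP e Ee.
exists (\bigcup_(e in F) (UK e).2); last by split => //; exact: compact_closed.
have UF : nbhs z (\bigcap_(e in F) (UK e).1).
  rewrite (_ : F = [set` fset_set F]); last by rewrite fset_setK.
  apply: filter_bigI => e; rewrite in_fset_set // => /set_mem[Ee _].
  by have [] := UKP e Ee.
apply: filterS (filterI Uz UF) => w [Uw UFw] _.
have : [set: T] w by []; rewrite -coverE => -[e Ee ew].
have Fe : F e by split => //; exists w.
by exists e => //; have [_ _] := UKP e Ee; apply; split => //; exact: UFw.
Qed.

End LocallyFiniteFamily.

(** * Quotients of a strip by the components of its horizontal slices *)

Lemma continuous_pair (T U V : topologicalType) (f : T -> U) (g : T -> V) :
  continuous f -> continuous g -> continuous (fun x => (f x, g x)).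
Proof. by move=> cf cg x; apply: (cvg_pair (cf x) (cg x)). Qed.

Lemma continuous_negr (R : realType) :
  continuous (fun p : R * R => (p.1, - p.2)).
Proof.
apply: continuous_pair => p; first exact: cvg_fst.
by apply: cvgN; exact: cvg_snd.
Qed.

Lemma continuous_negl (R : realType) :
  continuous (fun p : R * R => (- p.1, p.2)).
Proof.
apply: continuous_pair => p; last exact: cvg_snd.
by apply: cvgN; exact: cvg_fst.
Qed.

(* [tau q x] is the class of the point of the closed strip [c x <= q <= c x + a]
   at level [q] and abscissa [x]; outside the strip [q] is first clamped to
   [[c x, c x + a]], which makes [tau] continuous on the whole plane.  [S] plays
   the role of the critical set of [c]; [sq_gap] is all that is used of the
   separation of the critical values. *)
Record strip_quotient (R : realType) (T : topologicalType) (c : R -> R) (a : R)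
    (S : set R) (h : T -> R) (tau : R -> R -> T) : Prop := StripQuotient {
  sq_continuous : continuous c ;
  sq_width : 0 < a ;
  sq_closed : closed S ;
  sq_gap : forall s s', S s -> S s' ->
    (forall t u, s <= t <= s' -> s <= u <= s' -> c t - c u <= a) ->
    forall t, s <= t <= s' -> S t ;
  sq_const : forall s s', s <= s' -> (forall t, s <= t <= s' -> S t) ->
    c s = c s' ;
  sq_mono : forall x y, x < y -> (forall t, x < t < y -> ~ S t) ->
    (forall t u, x <= t -> t < u -> u <= y -> c t < c u) \/
    (forall t u, x <= t -> t < u -> u <= y -> c u < c t) ;
  sq_height : continuous h ;
  sq_tau : continuous (fun p : R * R => tau p.1 p.2) ;
  sq_open : forall U, open [set p : R * R | U (tau p.1 p.2)] -> open U ;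
  sq_surj : forall z, exists q x, tau q x = z ;
  sq_htau : forall q x, c x <= q <= c x + a -> h (tau q x) = q ;
  sq_clamp : forall q x, c x <= h (tau q x) <= c x + a /\
    tau (h (tau q x)) x = tau q x ;
  sq_eq : forall q x y, x <= y -> c x <= q <= c x + a -> c y <= q <= c y + a ->
    (tau q x = tau q y <-> forall t, x <= t <= y -> c t <= q <= c t + a) }.

(** * Symmetries of a strip quotient *)

Section Reflections.
Context {R : realType} {T : topologicalType} {c : R -> R} {a : R} {S : set R}.
Context {h : T -> R} {tau : R -> R -> T}.
Hypothesis H : strip_quotient c a S h tau.

(** The reflection of the abscissa reduces every statement about the right side to the left side. *)
Lemma strip_quotient_reflect : strip_quotient (c \o -%R) a (-%R @^-1` S) h
  (fun q x => tau q (- x)).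
Proof.
split=> /=.
- move=> x; apply: continuous_comp; first exact: opp_continuous.
  exact: (sq_continuous H).
- exact: (sq_width H).
- apply: preimage_closed (sq_closed H) => x _; exact: opp_continuous.
- move=> s s' Ss Ss' osc t st.
  apply: (sq_gap H Ss' Ss); last by move: st; lra.
  move=> u w us ws; have := osc (- u) (- w); rewrite !opprK; apply; lra.
- move=> s s' ss' Sss'; apply/esym/(sq_const H); first by rewrite lerN2.
  by move=> t st; rewrite -(opprK t); apply: Sss'; lra.
- move=> x y xy nS; have xy' : - y < - x by rewrite ltrN2.
  have [t ty|inc|dec] := sq_mono H xy'.
  + by have := nS (- t); rewrite opprK; apply; lra.
  + by right=> t u xt tu uy; apply: inc; lra.
  + by left=> t u xt tu uy; apply: dec; lra.
- exact: (sq_height H).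
- move=> p.
  apply: (@continuous_comp _ _ _ (fun p : R * R => (p.1, - p.2))
    (fun p => tau p.1 p.2)); last exact: (sq_tau H).
  exact: continuous_negr.
- move=> U oU; apply: (sq_open H).
  rewrite (_ : [set p | _] = (fun p : R * R => (p.1, - p.2)) @^-1`
      [set p | U (tau p.1 (- p.2))]); last first.
    by apply/seteqP; split => -[q x] /=; rewrite opprK.
  apply: open_comp => // p _.
  exact: continuous_negr.
- by move=> z; have [q [x <-]] := sq_surj H z; exists q, (- x); rewrite opprK.
- by move=> q x; exact: (sq_htau H).
- by move=> q x; exact: (sq_clamp H).
- move=> q x y xy cx cy; have xy' : - y <= - x by rewrite lerN2.
  have eqH := sq_eq H xy' cy cx; split=> [e t ty|e].
    by apply: ((iffLR eqH) (esym e)); lra.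
  by apply/esym/eqH => t ty; rewrite -(opprK t); apply: e; lra.
Qed.

(** Changing the sign of the level turns the strip between [c] and [c + a] into the one between
    [- c - a] and [- c]. This exchanges increasing and decreasing gaps. *)
Lemma strip_quotient_flip : strip_quotient (fun x => - c x - a) a S (\- h)
  (fun q x => tau (- q) x).
Proof.
split=> /=.
- move=> x; apply: cvgB; last exact: cvg_cst.
  by apply: cvgN; exact: (sq_continuous H).
- exact: (sq_width H).
- exact: (sq_closed H).
- move=> s s' Ss Ss' osc t st; apply: (sq_gap H Ss Ss') => // u w us ws.
  have := osc w u ws us; lra.
- by move=> s s' ss' Sss'; rewrite (sq_const H ss' Sss').
- move=> x y xy nS; have [inc|dec] := sq_mono H xy nS.
  + by right=> t u xt tu uy; have := inc t u xt tu uy; lra.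
  + by left=> t u xt tu uy; have := dec t u xt tu uy; lra.
- by move=> x; apply: cvgN; exact: (sq_height H).
- move=> p.
  apply: (@continuous_comp _ _ _ (fun p : R * R => (- p.1, p.2))
    (fun p => tau p.1 p.2)); last exact: (sq_tau H).
  exact: continuous_negl.
- move=> U oU; apply: (sq_open H).
  rewrite (_ : [set p | _] = (fun p : R * R => (- p.1, p.2)) @^-1`
      [set p | U (tau (- p.1) p.2)]); last first.
    by apply/seteqP; split => -[q x] /=; rewrite opprK.
  apply: open_comp => // p _.
  exact: continuous_negl.
- by move=> z; have [q [x <-]] := sq_surj H z; exists (- q), x; rewrite opprK.
- by move=> q x cq; rewrite (sq_htau H) ?opprK //; lra.
- move=> q x; rewrite opprK; have [cq ->] := sq_clamp H (- q) x; split => //; lra.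
- move=> q x y xy cx cy.
  have cx' : c x <= - q <= c x + a by lra.
  have cy' : c y <= - q <= c y + a by lra.
  have e := sq_eq H xy cx' cy'; split=> [/e st t /st|st]; first by lra.
  by apply/e => t /st; lra.
Qed.

End Reflections.

(* The interval of abscissas over which the class [z] lies. *)
Definition levels (R : realType) (T : topologicalType) (c : R -> R) (a : R)
    (h : T -> R) (tau : R -> R -> T) (z : T) : set R :=
  [set x | c x <= h z <= c x + a /\ tau (h z) x = z].

(** * Intervals of abscissas and the topology of the quotient *)

Section Levels.
Context {R : realType} {T : topologicalType} {c : R -> R} {a : R} {S : set R}.
Context {h : T -> R} {tau : R -> R -> T}.
Hypothesis H : strip_quotient c a S h tau.
Local Notation C := (levels c a h tau).

Lemma levels_nonempty z : C z !=set0.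
Proof.
by have [q [x <-]] := sq_surj H z; exists x; exact: (sq_clamp H).
Qed.

Lemma levels_tau_clamp q x : C (tau q x) x.
Proof. exact: (sq_clamp H). Qed.

Lemma levels_tau q x : c x <= q <= c x + a -> C (tau q x) x.
Proof. by move=> cx; rewrite /levels /= (sq_htau H). Qed.

Lemma levels_inj z w x : C z x -> C w x -> h z = h w -> z = w.
Proof. by move=> [_ zx] [_ wx] hzw; rewrite -[LHS]zx -[RHS]wx hzw. Qed.

Lemma levelsP z x y : C z x -> x <= y ->
  (C z y <-> forall t, x <= t <= y -> c t <= h z <= c t + a).
Proof.
move=> [cx zx] xy; split=> [[cy zy]|e].
  by apply/(sq_eq H xy cx cy); rewrite zx zy.
have cy : c y <= h z <= c y + a by apply: e; rewrite xy lexx.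
by split => //; rewrite -[RHS]zx; apply/esym/(sq_eq H xy cx cy).
Qed.

Lemma levelsP_left z x y : C z y -> x <= y ->
  (C z x <-> forall t, x <= t <= y -> c t <= h z <= c t + a).
Proof.
move=> [cy zy] xy; split=> [[cx zx]|e].
  by apply/(sq_eq H xy cx cy); rewrite zx zy.
have cx : c x <= h z <= c x + a by apply: e; rewrite xy lexx.
by split => //; rewrite -[RHS]zy; apply/(sq_eq H xy cx cy).
Qed.

Lemma levels_convex z x y t : C z x -> C z y -> x <= t <= y -> C z t.
Proof.
move=> zx zy /andP[xt ty]; apply/(levelsP zx xt) => u /andP[xu ut].
by apply: (iffLR (levelsP zx (le_trans xt ty))) => //; rewrite xu (le_trans ut).
Qed.

(** If the interval of [z] stays to the right of [s], the horizontal line at height [h z] leaves the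
    strip at some [t >= s] to the left of the interval. The same [t] is a barrier for all nearby
    classes, so the set is a union of the open sets [B t]. *)
Lemma levels_gt_open s : open [set z | forall x, C z x -> s < x].
Proof.
set A := [set z | _].
pose B t : set T := [set z | ~ (c t <= h z <= c t + a)] `&`
  [set z | forall x, C z x -> t < x].
have -> : A = \bigcup_(t in [set t | s <= t]) B t.
  apply/seteqP; split=> [z Az|z [t /= st [_ Bt]] x /Bt]; last exact: le_lt_trans.
  have [x zx] := levels_nonempty z; have sx := Az x zx.
  have : ~ C z s by move=> /Az; rewrite ltxx.
  move=> /(contra_not (iffRL (levelsP_left zx (ltW sx)))).
  move=> /existsNP[t /not_implyP[/andP[st tx] nt]]; exists t => //; split => //.
  have {}tx : t < x.
    rewrite lt_neqAle tx andbT; apply/eqP => tx'.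
    by apply: nt; rewrite tx'; case: zx.
  move=> y zy; rewrite ltNge; apply/negP => yt; apply: nt.
  have zt : C z t by apply: levels_convex zy zx _; rewrite yt ltW.
  by case: zt.
apply: bigcup_open => t _; apply: (sq_open H).
(* A slice that misses the strip at [t] cannot cross [t], so one abscissa of the class decides on
   which side it lies. *)
have -> : [set p : R * R | B t (tau p.1 p.2)] =
    [set p | ~ (c t <= h (tau p.1 p.2) <= c t + a)] `&` [set p | t < p.2].
  apply/seteqP; split=> -[q x] /= [nt tx]; split => //.
    exact/tx/levels_tau_clamp.
  move=> y Cy; rewrite ltNge; apply/negP => yt; apply: nt.
  have zt : C (tau q x) t.
    by apply: levels_convex Cy (levels_tau_clamp q x) _; rewrite yt ltW.
  by case: zt.
apply: openI.
  rewrite (_ : [set p | _] = ~` ((fun p : R * R => h (tau p.1 p.2)) @^-1`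
      `[c t, c t + a]%classic)); last first.
    by apply/seteqP; split => p /=; rewrite in_itv.
  apply: closed_openC; apply: preimage_closed; last exact: itv_closed.
  by move=> p _; apply: continuous_comp; [exact: (sq_tau H)|exact: (sq_height H)].
apply: (@open_comp _ _ snd [set x | t < x]); last exact: open_gt.
by move=> p _; exact: cvg_snd.
Qed.

End Levels.

Section LevelsTopology.
Context {R : realType} {T : topologicalType} {c : R -> R} {a : R} {S : set R}.
Context {h : T -> R} {tau : R -> R -> T}.
Hypothesis H : strip_quotient c a S h tau.
Local Notation C := (levels c a h tau).

Lemma levels_reflect z x :
  levels (c \o -%R) a h (fun q x => tau q (- x)) z x <-> C z (- x).
Proof. by []. Qed.

Lemma levels_lt_open s : open [set z | forall x, C z x -> x < s].
Proof.
have := levels_gt_open (strip_quotient_reflect H) (- s).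
rewrite (_ : [set z | _] = [set z | forall x, C z x -> x < s]) //.
apply/seteqP; split=> z zs x zx; last by move/zs: zx; lra.
by have := zs (- x); rewrite levels_reflect opprK => /(_ zx); lra.
Qed.

(** Classes of different height are separated by [h]. Two classes of the same height are separated
    by an abscissa between them at which the slice leaves the strip. *)
Lemma strip_quotient_hausdorff : hausdorff_space T.
Proof.
have sep z w x y : h z = h w -> z != w -> C z x -> C w y -> x <= y ->
    exists A B : set T, [/\ open A, open B, A z, B w & A `&` B = set0].
  move=> hzw zw zx wy xy.
  have : ~ C z y by move=> zy; move/eqP: zw; apply; exact: levels_inj zy wy hzw.
  move=> /(contra_not (iffRL (levelsP H zx xy))).
  move=> /existsNP[t /not_implyP[/andP[xt ty] nt]].
  exists [set v | forall u, C v u -> u < t], [set v | forall u, C v u -> t < u].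
  split; [exact: levels_lt_open|exact: (levels_gt_open H)| | |].
  - move=> u zu; rewrite ltNge; apply/negP => tu; apply: nt.
    have zt : C z t by apply: (levels_convex H) zx zu _; rewrite xt.
    by case: zt.
  - move=> u wu; rewrite ltNge; apply/negP => tu; apply: nt; rewrite hzw.
    have wt : C w t by apply: (levels_convex H) wu wy _; rewrite tu.
    by case: wt.
  - apply/seteqP; split=> // v [vlt vgt].
    have [u vu] := levels_nonempty H v.
    by have := vlt u vu; rewrite ltNge (ltW (vgt u vu)).
rewrite open_hausdorff => z w zw.
have [hzw|hzw] := eqVneq (h z) (h w).
  have [x zx] := levels_nonempty H z; have [y wy] := levels_nonempty H w.
  have [xy|/ltW yx] := leP x y.
    have [A [B [oA oB Az Bw AB]]] := sep _ _ _ _ hzw zw zx wy xy.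
    by exists (A, B) => /=; [split; exact/mem_set|rewrite AB].
  rewrite eq_sym in zw.
  have [A [B [oA oB Az Bw AB]]] := sep _ _ _ _ (esym hzw) zw wy zx yx.
  by exists (B, A) => /=; [split; exact/mem_set|rewrite setIC AB].
have := @Rhausdorff R; rewrite open_hausdorff => /(_ _ _ hzw)[[A B]] /=.
move=> [/set_mem Az /set_mem Bw] [oA oB /eqP AB].
exists (h @^-1` A, h @^-1` B) => /=; first by split; exact/mem_set.
split; [| |by rewrite -preimage_setI AB preimage_set0].
- by apply: open_comp oA => ? _; exact: (sq_height H).
- by apply: open_comp oB => ? _; exact: (sq_height H).
Qed.

Lemma continuous_tau_line (f g : R -> R) : continuous f -> continuous g ->
  continuous (fun t => tau (f t) (g t)).
Proof.
move=> cf cg t.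
apply: (@continuous_comp _ _ _ (fun t => (f t, g t)) (fun p => tau p.1 p.2)).
  exact: continuous_pair.
exact: (sq_tau H).
Qed.

(** The images of the vertical lines cover the space, and each of them meets the image of the graph
    of [c]. *)
Lemma strip_quotient_connected : connected [set: T].
Proof.
have conn_line (f g : R -> R) : continuous f -> continuous g ->
    connected (range (fun t => tau (f t) (g t))).
  move=> cf cg.
  apply: (@connected_continuous_connected R _ setT
    (fun t => tau (f t) (g t))).
    by apply/connected_intervalP => x y _ _ z _.
  by apply: continuous_subspaceT; exact: continuous_tau_line.
rewrite (_ : [set: T] = \bigcup_(x in [set: R])
    (range (tau ^~ x) `|` range (fun t => tau (c t) t))); last first.
  apply/seteqP; split=> z // _; have [q [x <-]] := sq_surj H z.
  by exists x => //; left; exists q.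
apply: bigcup_connected.
  by exists (tau (c 0) 0) => x _; right; exists 0.
move=> x _; apply: connectedU.
- by exists (tau (c x) x); split; [exists (c x)|exists x].
- by apply: (conn_line id (fun=> x)) => t; [exact: cvg_id|exact: cvg_cst].
- by apply: (conn_line c id) => t; [exact: (sq_continuous H)|exact: cvg_id].
Qed.

End LevelsTopology.

Section LevelsNeighbourhoods.
Context {R : realType} {T : topologicalType}.
Implicit Types (c : R -> R) (a : R) (S F : set R) (h : T -> R).
Implicit Types (tau : R -> R -> T).

(** It is enough to stay to the right of the greatest element of [F] below [x], an open condition by
    [levels_gt_open]. *)
Lemma levels_avoid_left c a S h tau F z x : strip_quotient c a S h tau ->
  closed F -> levels c a h tau z `&` F = set0 -> levels c a h tau z x ->
  \forall w \near z, forall f, F f -> f <= x ->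
    forall y, levels c a h tau w y -> f < y.
Proof.
move=> H cF zF zx; have [[f0 [Ff0 f0x]]|nf] := pselect (exists f, F f /\ f <= x).
  pose A := F `&` [set f | f <= x].
  have cA : closed A by apply: closedI => //; exact: closed_le.
  have A0 : A !=set0 by exists f0.
  have hA : has_ubound A by exists x => f [].
  have [Fs sx] : A (sup A).
    by apply: cA; exact: closure_sup.
  have zs y : levels c a h tau z y -> sup A < y.
    move=> zy; rewrite ltNge; apply/negP => ys.
    have zs : levels c a h tau z (sup A).
      by apply: (levels_convex H) zy zx _; rewrite ys.
    have : (levels c a h tau z `&` F) (sup A) by [].
    by rewrite zF.
  have := open_nbhs_nbhs (conj (levels_gt_open H (sup A)) zs).
  apply: filterS => w ws f Ff fx y wy; apply: le_lt_trans (ws y wy).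
  by apply: ub_le_sup.
by apply: nearW => w f Ff fx; exfalso; apply: nf; exists f.
Qed.

(** Upper semicontinuity of the interval of abscissas. The intervals may be unbounded, so
    compactness is replaced by avoiding the complement of [O] on the left and, by reflection, on the
    right. *)
Lemma levels_within_open c a S h tau (O : set R) :
  strip_quotient c a S h tau -> open O ->
  open [set z | levels c a h tau z `<=` O].
Proof.
move=> H oO; rewrite openE => z /= zO.
have cF : closed (~` O) by exact: open_closedC.
have zF : levels c a h tau z `&` ~` O = set0.
  by apply/seteqP; split=> // x [/zO].
have [x zx] := levels_nonempty H z.
have left := levels_avoid_left H cF zF zx.
have cF' : closed (-%R @^-1` (~` O)).
  by apply: preimage_closed cF => t _; exact: opp_continuous.
have zF' : levels (c \o -%R) a h (fun q x => tau q (- x)) z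
    `&` -%R @^-1` (~` O) = set0.
  by apply/seteqP; split=> // t [/levels_reflect/zO].
have zx' : levels (c \o -%R) a h (fun q x => tau q (- x)) z (- x).
  by apply/levels_reflect; rewrite opprK.
have right := levels_avoid_left (strip_quotient_reflect H) cF' zF' zx'.
rewrite /interior; apply: filterS2 left right => w wl wr y wy.
apply: contrapT => Fy; have [yx|/ltW xy] := leP y x.
  by have := wl y Fy yx y wy; rewrite ltxx.
have := wr (- y); rewrite /= opprK lerN2 => /(_ Fy xy (- y)).
by rewrite levels_reflect opprK ltxx => /(_ wy).
Qed.

End LevelsNeighbourhoods.

Section ClosedExtrema.
Context {R : realType} (A : set R).
Hypothesis cA : closed A.

Lemma closed_max x b : A x -> (forall y, A y -> y <= b) ->
  exists m, A m /\ forall y, A y -> y <= m.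
Proof.
move=> Ax Ab; have A0 : A !=set0 by exists x.
have hA : has_ubound A by exists b.
exists (sup A); split; first by apply: cA; exact: closure_sup.
by move=> y Ay; exact: ub_le_sup.
Qed.

End ClosedExtrema.

Lemma closed_min (R : realType) (A : set R) x b : closed A -> A x ->
  (forall y, A y -> b <= y) -> exists m, A m /\ forall y, A y -> m <= y.
Proof.
move=> cA Ax Ab; pose A' := -%R @^-1` A.
have cA' : closed A'.
  by apply: preimage_closed cA => t _; exact: opp_continuous.
have A'x : A' (- x) by rewrite /A' /= opprK.
have A'b y : A' y -> y <= - b by move=> /Ab; rewrite lerNr.
have [m [A'm mmax]] := closed_max cA' A'x A'b.
exists (- m); split=> // y Ay; rewrite lerNl; apply: mmax.
by rewrite /A' /= opprK.
Qed.

(** * Edges, vertices and stars *)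

Section Edges.
Context {R : realType} {T : topologicalType} (c : R -> R) (a : R) (S : set R).
Context (h : T -> R) (tau : R -> R -> T).
Local Notation C := (levels c a h tau).

Definition between (x y t : R) : Prop := x <= t <= y \/ y <= t <= x.

Definition piece_edge (s : R) : set T :=
  [set z | C z s /\ c s < h z < c s + a].

(** For [x] outside [S], the classes whose interval lies in the component of the complement of [S]
    that contains [x]. *)
Definition gap_edge (x : R) : set T :=
  [set z | forall y, C z y -> forall t, between x y t -> ~ S t].

Definition strip_edges : set (set T) :=
  [set e | (exists2 s, S s & e = piece_edge s) \/
           (exists2 x, ~ S x & e = gap_edge x)].

Definition strip_vertices : set T :=
  [set z | exists s, [/\ S s, C z s & h z = c s \/ h z = c s + a]].

(* For [s] in [S]: the union of the component of [S] containing [s] and of the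
   two adjacent components of the complement of [S]. *)
Definition collar (s : R) : set R :=
  [set y | forall u, S u -> between y s u -> forall t, between u s t -> S t].

(** An open neighbourhood of all classes over [s], shown below to meet the closures of at most three
    edges. *)
Definition star (s : R) : set T := [set z | C z `<=` collar s].

End Edges.

Section EdgeTheory.
Context {R : realType} {T : topologicalType} {c : R -> R} {a : R} {S : set R}.
Context {h : T -> R} {tau : R -> R -> T}.
Hypothesis H : strip_quotient c a S h tau.
Local Notation C := (levels c a h tau).
Local Notation piece := (piece_edge c a h tau).
Local Notation gap := (gap_edge c a S h tau).
Local Notation E := (strip_edges c a S h tau).
Local Notation V := (strip_vertices c a S h tau).
Local Notation star := (star c a S h tau).
Local Notation collar := (collar S).

Lemma gap_between s s' : S s -> S s' ->
  (forall t u, between s s' t -> between s s' u -> c t - c u <= a) ->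
  forall t, between s s' t -> S t.
Proof.
move=> Ss Ss' osc t; have [ss'|s's] := leP s s' => -[] st.
- by apply: (sq_gap H Ss Ss') => // u w us ws; apply: osc; left.
- by have -> : t = s by lra.
- by have -> : t = s by lra.
- by apply: (sq_gap H Ss' Ss) => // u w us ws; apply: osc; right.
Qed.

Lemma const_between s s' : (forall t, between s s' t -> S t) -> c s = c s'.
Proof.
move=> Sss'; have [ss'|/ltW s's] := leP s s'.
  by apply: (sq_const H ss') => t st; apply: Sss'; left.
by apply/esym/(sq_const H s's) => t st; apply: Sss'; right.
Qed.

Lemma levels_between z x y t : C z x -> C z y -> between x y t -> C z t.
Proof. by move=> zx zy [|] xt; apply: (levels_convex H) xt. Qed.

(** Over the interval of [z] the function [c] varies by at most [a], so by [sq_gap] this interval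
    meets only one component of [S]. *)
Lemma levels_piece z s s' : S s -> S s' -> C z s -> C z s' ->
  forall t, between s s' t -> S t.
Proof.
move=> Ss Ss' zs zs'; apply: gap_between => // t u st su.
have [ct _] := levels_between zs zs' st; have [cu _] := levels_between zs zs' su.
lra.
Qed.

Lemma ball_free x : ~ S x -> exists2 d, 0 < d & forall y, `|x - y| < d -> ~ S y.
Proof.
move=> nSx; have : nbhs x (~` S).
  by apply: open_nbhs_nbhs; split => //; apply: closed_openC; exact: (sq_closed H).
by move=> /nbhs_ballP[d /= d0 dS]; exists d => // y; exact: dS.
Qed.

Lemma ball_osc x : exists2 d, 0 < d &
  forall t u, `|x - t| < d -> `|x - u| < d -> c t - c u <= a.
Proof.
have a2 : 0 < a / 2 by rewrite divr_gt0 // (sq_width H).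
have /cvgrPdist_lt /(_ _ a2) := @sq_continuous _ _ _ _ _ _ _ H x.
move=> /nbhs_ballP[d /= d0 dc]; exists d => // t u xt xu.
have := dc _ xt; have := dc _ xu; rewrite /= !ltr_distlC; lra.
Qed.

(** Around a point outside [S] take a ball free of [S]. Around a point [y] of [S] take a ball on
    which [c] varies by at most [a]: every point of [S] in it is then joined to [y] inside [S]. *)
Lemma collar_open s : S s -> open (collar s).
Proof.
move=> Ss; rewrite openE => y ys; rewrite /interior; apply/nbhs_ballP.
have [Sy|nSy] := pselect (S y); last first.
  have [d d0 dS] := ball_free nSy; exists d => // y' yy' u Su y'su t ust.
  apply: (ys u Su) => //; have := dS u; have := @contrapT (S u).
  have nd : ~ (`|y - u| < d) by move=> /dS.
  move: nd yy'; rewrite /ball /= !ltr_distlC => /negP; rewrite negb_and -!leNgt.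
  by move=> /orP[] yu; move: y'su; rewrite /between; lra.
have [d d0 dosc] := ball_osc y; exists d => // y' yy' u Su y'su t ust.
have [yu|nyu] := pselect (between y s u); first exact: (ys u Su yu).
have yud : `|y - u| < d.
  by move: yy' nyu y'su; rewrite /ball /= !ltr_distlC /between; lra.
have uyS w : between u y w -> S w.
  apply: gap_between => // v v' uv uv'; apply: dosc;
  by move: yud uv uv'; rewrite !ltr_distlC /between; lra.
have [uy|nuy] := pselect (between u y t); first exact: uyS.
by apply: (ys y Sy); move: nuy nyu ust y'su; rewrite /between; lra.
Qed.

Lemma star_open s : S s -> open (star s).
Proof. by move=> Ss; apply: (levels_within_open H); exact: collar_open. Qed.

Lemma levels_star z s : S s -> C z s -> star s z.
Proof.
move=> Ss zs y zy u Su ysu; apply: (levels_piece Su Ss _ zs).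
exact: levels_between zy zs ysu.
Qed.

(** From [y] to the component of [s] the function [c] is monotone, and then it is constant. Its
    values thus lie between [c y] and [c s], and both are compatible with the level of [z]. *)
Lemma collar_level_left s z y : S s -> C z y -> collar s y -> y <= s ->
  c s <= h z <= c s + a -> C z s.
Proof.
move=> Ss zy sy ys hs; apply/(levelsP H zy ys) => t /andP[yt ts].
have [cy _] := zy.
have constS u : S u -> y <= u <= s -> forall w, u <= w <= s -> S w.
  by move=> Su yu w uw; apply: (sy u Su); [left|left].
have [[u [Su /andP[yu ut]]]|nu] := pselect (exists u, S u /\ y <= u <= t).
  have -> // : c t = c s; apply: (sq_const H ts) => w /andP[tw ws].
  by apply: (constS u Su); rewrite ?yu ?ws ?andbT ?(le_trans ut).
(* The least element [r] of [A] is the left end of the component of [s]; between [y] and [r] there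
   is no critical point. *)
pose A := S `&` [set u | t <= u].
have cA : closed A.
  by apply: closedI; [exact: (sq_closed H)|exact: closed_ge].
have As : A s by [].
have [r [[Sr tr] rmin]] : exists r, A r /\ forall u, A u -> r <= u.
  by apply: (closed_min (b := t) cA As) => u [].
have rs : r <= s by exact: rmin.
have yr : y < r.
  rewrite lt_neqAle (le_trans yt tr) andbT; apply/eqP => yr.
  by apply: nu; exists r; split => //; rewrite -yr lexx.
have rc : c r = c s.
  by apply: (sq_const H rs) => w; apply: constS; rewrite // (le_trans yt tr).
have free w : y < w < r -> ~ S w.
  move=> /andP[yw wr] Sw; have [wt|/ltW tw] := leP w t.
    by apply: nu; exists w; split => //; rewrite (ltW yw).
  by have := rmin _ (conj Sw tw); rewrite leNgt wr.
have cle (f : R -> R) : (forall u w, y <= u -> u < w -> w <= r -> f u < f w) ->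
    f y <= f t <= f r.
  move=> mono; apply/andP; split.
    have [yt'|ty] := ltP y t; [exact/ltW/mono|].
    by have -> : y = t by apply/le_anti; rewrite yt.
  have [tr'|rt] := ltP t r; [exact/ltW/mono|].
  by have -> : t = r by apply/le_anti; rewrite tr.
have [inc|dec] := sq_mono H yr free.
  by have := cle c inc; lra.
have : - c y <= - c t <= - c r.
  by apply: (cle (fun x => - c x)) => u w yu uw wr; rewrite ltrN2 dec.
lra.
Qed.

End EdgeTheory.

Section EdgeCombinatorics.
Context {R : realType} {T : topologicalType} {c : R -> R} {a : R} {S : set R}.
Context {h : T -> R} {tau : R -> R -> T}.
Hypothesis H : strip_quotient c a S h tau.
Local Notation C := (levels c a h tau).
Local Notation piece := (piece_edge c a h tau).
Local Notation gap := (gap_edge c a S h tau).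
Local Notation E := (strip_edges c a S h tau).
Local Notation V := (strip_vertices c a S h tau).
Local Notation star := (star c a S h tau).
Local Notation collar := (collar S).

Lemma betweenC (x y t : R) : between x y t -> between y x t.
Proof. by case; [right|left]. Qed.

Lemma betweenN (x y t : R) : between (- x) (- y) t -> between x y (- t).
Proof. by rewrite /between; lra. Qed.

(** Inside the star the level alone decides whether a class lies over [s]. This gives the openness
    of [piece s] and the degree at local extrema. *)
Lemma star_level s z : S s -> star s z -> c s <= h z <= c s + a -> C z s.
Proof.
move=> Ss zs hs; have [y zy] := levels_nonempty H z; have sy := zs y zy.
have [ys|/ltW ys] := leP y s; first exact: (collar_level_left H Ss zy sy).
have := @collar_level_left _ _ _ _ _ _ _ (strip_quotient_reflect H) (- s) z (- y).
rewrite /levels /= !opprK; apply=> //; last by rewrite lerN2.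
move=> u Su yu t ut; apply: (sy _ Su); first exact: betweenN.
by apply: betweenN; rewrite opprK.
Qed.

Lemma piece_open s : S s -> open (piece s).
Proof.
move=> Ss; rewrite (_ : piece s = star s `&` h @^-1` `]c s, c s + a[%classic).
  apply: openI; first exact: (star_open H).
  by apply: open_comp; [move=> ? _; exact: (sq_height H)|exact: interval_open].
apply/seteqP; split=> z.
  by move=> [zs hz]; split; [exact: (levels_star H)|rewrite /= in_itv].
move=> [zs]; rewrite /= in_itv /= => hz; split=> //.
by apply: star_level => //; lra.
Qed.

Lemma gap_open x : open (gap x).
Proof.
apply: (levels_within_open H (O := [set y | forall t, between x y t -> ~ S t])).
rewrite openE => y xy; rewrite /interior; apply/nbhs_ballP.
have nSy : ~ S y by apply: xy; rewrite /between; lra.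
have [d d0 dS] := ball_free H nSy; exists d => // y' yy' t xt.
have [xyt|nxyt] := pselect (between x y t); first exact: xy.
apply: dS; move: yy' nxyt xt.
by rewrite /ball /= !ltr_distlC /between; lra.
Qed.

Lemma edge_open e : E e -> open e.
Proof. by move=> [[s Ss ->]|[x _ ->]]; [exact: piece_open|exact: gap_open]. Qed.

Lemma piece_inj s s' : S s -> S s' -> (forall t, between s s' t -> S t) ->
  piece s = piece s'.
Proof.
suff sub s1 s2 : (forall t, between s1 s2 t -> S t) -> piece s1 `<=` piece s2.
  move=> Ss Ss' Sss'; apply/seteqP; split; apply: sub => // t /betweenC.
  exact: Sss'.
move=> Sss z [zs hz]; have cs := const_between H Sss.
split; last by rewrite -cs.
have hz' : c s1 <= h z <= c s1 + a by lra.
have line t : between s1 s2 t -> c t <= h z <= c t + a.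
  move=> st; rewrite -(const_between H (s := s1)) // => u su; apply: Sss.
  by move: st su; rewrite /between; lra.
have [ss|/ltW ss] := leP s1 s2.
  by apply/(levelsP H zs ss) => t st; apply: line; left.
by apply/(levelsP_left H zs ss) => t st; apply: line; right.
Qed.

Lemma gap_inj x y z : gap x z -> C z y -> gap x = gap y.
Proof.
move=> xz zy; have free t : between x y t -> ~ S t by exact: xz.
apply/seteqP; split=> w wg u wu t tu Su.
  have [xt|nxt] := pselect (between x u t); first exact: wg xt Su.
  by apply: (free t _ Su); move: tu nxt; rewrite /between; lra.
have [xt|nxt] := pselect (between y u t); first exact: wg xt Su.
by apply: (free t _ Su); move: tu nxt; rewrite /between; lra.
Qed.

Lemma piece_gap s x z : S s -> piece s z -> ~ gap x z.
Proof. by move=> Ss [zs _] /(_ s zs s); apply => //; rewrite /between; lra. Qed.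

Lemma edges_disjoint : trivIset E id.
Proof.
move=> e e' [[s Ss ->]|[x nx ->]] [[s' Ss' ->]|[x' nx' ->]] [z [/= ze ze']].
- apply: piece_inj => //; case: ze ze' => zs _ [zs' _].
  exact: (levels_piece H Ss Ss' zs zs').
- by case: (piece_gap Ss ze ze').
- by case: (piece_gap Ss' ze' ze).
- have [y zy] := levels_nonempty H z.
  by rewrite (gap_inj ze zy) (gap_inj ze' zy).
Qed.

Lemma edges_cover : V `|` \bigcup_(e in E) e = [set: T].
Proof.
apply/seteqP; split=> // z _.
have [[s [Ss zs]]|nS] := pselect (exists s, S s /\ C z s).
  have [cs _] := zs.
  have [hz|/eqP hz] := eqVneq (h z) (c s); first by left; exists s; split; auto.
  have [hz'|/eqP hz'] := eqVneq (h z) (c s + a).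
    by left; exists s; split; auto.
  right; exists (piece s); first by left; exists s.
  have /andP[c1 c2] := cs; split => //.
  by rewrite !lt_neqAle c1 c2 !andbT; apply/andP; split; apply/eqP; auto.
right; have [x zx] := levels_nonempty H z.
exists (gap x); first by right; exists x => // Sx; apply: nS; exists x.
move=> y zy t xt St; apply: nS; exists t; split => //.
exact: (levels_between H zx zy).
Qed.

Lemma edges_vertices e : E e -> e `&` V = set0.
Proof.
move=> Ee; apply/seteqP; split=> // z [ze [s [Ss zs hz]]].
case: Ee ze => [[s' Ss' ->]|[x nx ->]].
  move=> [zs' hz']; have := const_between H (levels_piece H Ss Ss' zs zs').
  lra.
by move=> /(_ s zs s); apply => //; rewrite /between; lra.
Qed.

(** The edges are open and disjoint, so the closure of one of them cannot meet another. *)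
Lemma edges_boundary e : E e -> closure e `\` e `<=` V.
Proof.
move=> Ee z [clz nez]; have : [set: T] z by []; rewrite -edges_cover.
move=> [//|[e' Ee' e'z]].
have [w [ew e'w]] := clz _ (open_nbhs_nbhs (conj (edge_open Ee') e'z)).
by exfalso; apply: nez; rewrite (edges_disjoint Ee Ee') //; exists w.
Qed.

Lemma closure_edge_open e (U : set T) : open U -> closure e `&` U !=set0 ->
  e `&` U !=set0.
Proof.
by move=> oU [z [clz Uz]]; exact: (clz _ (open_nbhs_nbhs (conj oU Uz))).
Qed.

(** Besides [piece s], only the gap edge on either side of the component of [s] can come near. *)
Lemma star_edges s : S s -> exists eL eR, forall e, E e ->
  closure e `&` star s !=set0 -> [\/ e = piece s, e = eL | e = eR].
Proof.
move=> Ss.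
pose P (D : set R) e := exists y, [/\ D y, collar s y, ~ S y & e = gap y].
pose L := [set y | y < s]; pose G := [set y | s < y].
(* A point of [S] between [y] and [y'] would be joined to [s] inside [S], so the one of [y] and [y']
   nearer to [s] would belong to [S]. *)
have uniq D : D = L \/ D = G -> forall e e', P D e -> P D e' -> e = e'.
  move=> DLG e e' [y [Dy sy nSy ->]] [y' [Dy' sy' nSy' ->]].
  have free t : between y y' t -> ~ S t.
    move=> yt St; have [yy'|y'y] := leP y y'.
      case: DLG Dy Dy' => ->; rewrite /L /G /= => Dy Dy'.
        by apply: nSy'; apply: (sy t St); move: yt; rewrite /between; lra.
      by apply: nSy; apply: (sy' t St); move: yt; rewrite /between; lra.
    case: DLG Dy Dy' => ->; rewrite /L /G /= => Dy Dy'.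
      by apply: nSy; apply: (sy' t St); move: yt; rewrite /between; lra.
    by apply: nSy'; apply: (sy t St); move: yt; rewrite /between; lra.
  apply/seteqP; split=> w wg u wu t tu Su.
    have [xt|nxt] := pselect (between y u t); first exact: wg xt Su.
    by apply: (free t _ Su); move: tu nxt; rewrite /between; lra.
  have [xt|nxt] := pselect (between y' u t); first exact: wg xt Su.
  by apply: (free t _ Su); move: tu nxt; rewrite /between; lra.
(* On a side without a gap the default value [piece s] adds no new edge. *)
exists (xget (piece s) (P L)), (xget (piece s) (P G)) => e Ee.
move=> /(closure_edge_open (star_open H Ss))[w [ew sw]].
have [y wy] := levels_nonempty H w; have sy := sw y wy.
case: Ee ew => [[s' Ss' ->]|[x nx ->]] ew.
  apply: Or31; apply/esym/piece_inj => // t st; case: ew => ws' _.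
  apply: (sw s' ws' s' Ss'); first by rewrite /between; lra.
  exact: betweenC.
have nSy : ~ S y by apply: (ew y wy); rewrite /between; lra.
rewrite (gap_inj ew wy); have [ys|sy'|ys] := ltgtP y s.
- apply: Or32; apply: (uniq L) => //; [by left|by exists y|].
  by case: xgetP => // n; exfalso; apply: (n (gap y)); exists y.
- apply: Or33; apply: (uniq G) => //; [by right|by exists y|].
  by case: xgetP => // n; exfalso; apply: (n (gap y)); exists y.
- by exfalso; apply: nSy; rewrite ys.
Qed.

Lemma star_vertices s z : S s -> V z -> star s z ->
  z = tau (c s) s \/ z = tau (c s + a) s.
Proof.
move=> Ss [s' [Ss' zs' hz]] zs; have cs : c s' = c s.
  apply: (const_between H); apply: (zs s' zs' s' Ss').
  by rewrite /between; lra.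
have [_ <-] : C z s by apply: star_level => //; have := sq_width H; lra.
by case: hz => ->; rewrite cs; [left|right].
Qed.

(** A vertex is given its star as neighbourhood, a point of an edge the open edge itself. *)
Lemma edges_locally_finite (x : T) : exists2 U : set T, nbhs x U &
  finite_set (V `&` U) /\ finite_set [set e | E e /\ closure e `&` U !=set0].
Proof.
have : [set: T] x by []; rewrite -edges_cover => -[[s [Ss xs hx]]|[e Ee ex]].
  exists (star s).
    by apply: open_nbhs_nbhs; split; [exact: (star_open H)|exact: (levels_star H)].
  split.
    apply: (@sub_finite_set _ _ [set tau (c s) s; tau (c s + a) s]).
      by move=> z [Vz zs]; have [->|->] := star_vertices Ss Vz zs; [left|right].
    exact: finite_set2.
  have [eL [eR LR]] := star_edges Ss.
  apply: (@sub_finite_set _ _ [set piece s; eL; eR]).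
    by move=> e [Ee es]; have [->|->|->] := LR e Ee es;
      [left; left|left; right|right].
  by rewrite finite_setU; split; [exact: finite_set2|exact: finite_set1].
exists e; first by apply: open_nbhs_nbhs; split => //; exact: edge_open.
split; first by rewrite setIC edges_vertices.
apply: (@sub_finite_set _ _ [set e]); last exact: finite_set1.
move=> e' [Ee' /(closure_edge_open (edge_open Ee)) ee'].
exact: edges_disjoint.
Qed.

End EdgeCombinatorics.

(** * Parametrization of the edges *)

(** Points of the segment are shrunk towards 0, points of the half-line are shifted to the right. *)
Lemma closed_cell_closure (R : realType) (D D0 : set R) :
  closed_cell D D0 -> D `<=` closure D0.
Proof.
move=> DD0 x Dx B /nbhs_ballP[d /= d0 dB].
pose e := Num.min (d / 2) (1 / 2).
have e0 : 0 < e by rewrite lt_min; apply/andP; split; lra.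
have ed : e < d by rewrite gt_min; apply/orP; left; lra.
have e1 : e < 1 by rewrite gt_min; apply/orP; right; lra.
case: DD0 Dx => -[-> ->] /=; rewrite in_itv /= ?andbT => Dx.
  exists ((1 - e) * x); split.
    by rewrite /= in_itv /=; nra.
  by apply: dB; rewrite /ball /= ltr_distlC; nra.
exists (x + e); split; first by rewrite /= in_itv /= andbT; lra.
by apply: dB; rewrite /ball /= ltr_distlC; lra.
Qed.

Lemma arc_edge_image (R : realType) (T : topologicalType) (h : T -> R)
    (D D0 : set R) (phi : R -> T) :
  closed_cell D D0 -> continuous phi -> closed (phi @` D) ->
  (forall x y, D x -> D y -> x < y -> h (phi x) < h (phi y)) ->
  arc_edge h (phi @` D0).
Proof.
move=> DD0 cphi cD mono; exists D, D0, phi; split=> //.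
have D0D : D0 `<=` D.
  case: DD0 => -[-> ->] x /=; rewrite !in_itv /= ?andbT; last exact: ltW.
  by move=> /andP[/ltW -> /ltW ->].
apply/seteqP; split.
  rewrite [X in _ `<=` X](closure_id _).1 //.
  by apply: closureS => _ [x /D0D ? <-]; exists x.
move=> _ [x Dx <-] W /(cphi x)/(closed_cell_closure DD0 Dx)[y [D0y Wy]].
by exists (phi y); split => //; exists y.
Qed.

Section EdgeArcs.
Context {R : realType} {T : topologicalType} {c : R -> R} {a : R} {S : set R}.
Context {h : T -> R} {tau : R -> R -> T}.
Hypothesis H : strip_quotient c a S h tau.
Local Notation C := (levels c a h tau).
Local Notation piece := (piece_edge c a h tau).
Local Notation gap := (gap_edge c a S h tau).



Lemma continuous_affine (k l : R) : continuous (fun t : R => k + l * (1 + t)).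
Proof.
move=> t; apply: cvgD; first exact: cvg_cst.
apply: cvgM; first exact: cvg_cst.
by apply: cvgD; [exact: cvg_cst|exact: cvg_id].
Qed.

Lemma affine_cell (k l : R) : 0 < l ->
  (fun t => k + l * (1 + t)) @` `](-1), 1[ = `]k, (k + l * 2)[%classic /\
  (fun t => k + l * (1 + t)) @` `[(-1), 1] = `[k, (k + l * 2)]%classic.
Proof.
move=> l0; have inv r : k + l * (1 + ((r - k) / l - 1)) = r.
  by rewrite (addrC 1) subrK mulrC divfK ?gt_eqF // addrC subrK.
have le_inv r : (k <= r <= k + l * 2) = (-1 <= (r - k) / l - 1 <= 1).
  by rewrite lerBrDr addNr lerBlDr ler_pdivlMr // ler_pdivrMr // mul0r; lra.
have lt_inv r : (k < r < k + l * 2) = (-1 < (r - k) / l - 1 < 1).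
  by rewrite ltrBrDr addNr ltrBlDr ltr_pdivlMr // ltr_pdivrMr // mul0r; lra.
split; apply/seteqP; split=> [_ [t + <-]|r]; rewrite /= !in_itv /=; [nra| |nra|].
  by rewrite lt_inv => tr; exists ((r - k) / l - 1).
by rewrite le_inv => tr; exists ((r - k) / l - 1).
Qed.

Lemma arc_edge_segment (psi : R -> T) (k l : R) : 0 < l -> continuous psi ->
  (forall x y, k <= x -> x < y -> y <= k + l * 2 -> h (psi x) < h (psi y)) ->
  arc_edge h (psi @` `]k, (k + l * 2)[).
Proof.
move=> l0 cpsi mono; have [img0 img] := affine_cell k l0.
rewrite -img0 image_comp.
have cphi : continuous (psi \o (fun t => k + l * (1 + t))).
  by move=> t; apply: continuous_comp; [exact: continuous_affine|exact: cpsi].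
apply: (@arc_edge_image _ _ _ `[(-1), 1]%classic) => //; first by left.
- apply: compact_closed; first exact: (strip_quotient_hausdorff H).
  apply: continuous_compact; last exact: segment_compact.
  exact: continuous_subspaceT.
- move=> x y /=; rewrite !in_itv /= => x1 y1 xy; apply: mono.
  + by rewrite lerDl mulr_ge0 //; lra.
  + by rewrite ltrD2l ltr_pM2l // ltrD2l.
  + by rewrite lerD2l ler_pM2l //; lra.
Qed.

(** The edge is the image of the vertical segment over [s], parametrized by the level. *)
Lemma piece_arc s : arc_edge h (piece s).
Proof.
have a0 := sq_width H; have a2 : 0 < a / 2 by lra.
have e2 : c s + a / 2 * 2 = c s + a by lra.
have := @arc_edge_segment (tau ^~ s) (c s) (a / 2) a2.
rewrite e2 (_ : _ @` _ = piece s); last first.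
  apply/seteqP; split=> [_ [q + <-]|z [[_ zs] hz]]; last first.
    by exists (h z) => //; rewrite /= in_itv.
  rewrite /= in_itv /= => qs; have qs' : c s <= q <= c s + a by lra.
  by split; [exact: (levels_tau H)|rewrite (sq_htau H)].
apply; first by apply: (continuous_tau_line H (f := id) (g := fun=> s)) => t;
  [exact: cvg_id|exact: cvg_cst].
by move=> x y sx xy ys; rewrite !(sq_htau H) //; lra.
Qed.

(** The condition on [w] describes the convex hull of [x] and the open interval from [t] to [u].
    Thus [t] and [u] range over the closure of the gap of [x], including its ends in [S]. *)
Definition gap_increasing x (f : R -> R) : Prop := forall t u, t < u ->
  (forall w, t < w \/ x <= w -> w < u \/ w <= x -> ~ S w) -> f t < f u.

(** Counterexamples to both alternatives would lie in one interval with interior free of [S], on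
    which [c] is strictly monotone. *)
Lemma gap_direction x : gap_increasing x c \/ gap_increasing x (\- c).
Proof.
apply: contrapT => /not_orP[].
move=> /existsNP[t /existsNP[u /not_implyP[tu /not_implyP[free ntu]]]].
move=> /existsNP[t' /existsNP[u' /not_implyP[tu' /not_implyP[free' ntu']]]].
pose m := Num.min t t'; pose M := Num.max u u'.
have mt : m <= t by rewrite ge_min lexx.
have mt' : m <= t' by rewrite ge_min lexx orbT.
have uM : u <= M by rewrite le_max lexx.
have uM' : u' <= M by rewrite le_max lexx orbT.
have [||inc|dec] := @sq_mono _ _ _ _ _ _ _ H m M.
- lra.
- move=> w /andP[]; rewrite gt_min lt_max => mw wM.
  have [wx|/ltW xw] := leP w x.
    by case/orP: mw => tw; [apply: free|apply: free']; auto.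
  by case/orP: wM => tw; [apply: free|apply: free']; auto.
- by apply: ntu; exact: inc.
- by apply: ntu'; rewrite /= ltrN2; exact: dec.
Qed.

(** Let [al] be the left end of the gap. Each class of the gap contains exactly one point of the
    upper boundary, so the edge is traced by the points of abscissa [y] and level [c y + a],
    starting at [al]. It is a half-line if the gap has no right end, and otherwise stops where the
    slice reaches the right end. *)
Lemma gap_arc_left x : ~ S x -> gap_increasing x c ->
  (exists2 s, S s & s < x) -> arc_edge h (gap x).
Proof.
move=> nSx inc [s0 Ss0 s0x]; have a0 := sq_width H.
have [al [[Sal alx] almax]] : exists m, (S `&` [set s | s <= x]) m /\
    forall y, (S `&` [set s | s <= x]) y -> y <= m.
  apply: (@closed_max _ _ _ s0 x).
  - by apply: closedI; [exact: (sq_closed H)|exact: closed_le].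
  - by split => //; exact: ltW.
  - by move=> y [].
have {}alx : al < x.
  by rewrite lt_neqAle alx andbT; apply/eqP => e; apply: nSx; rewrite -e.
have left_free w : al < w -> w <= x -> ~ S w.
  by move=> alw wx Sw; have := almax w (conj Sw wx); rewrite leNgt alw.
have incr t u : al <= t -> t < u -> (forall w, x <= w -> w < u -> ~ S w) ->
    c t < c u.
  move=> alt tu right_free; apply: inc => // w tw wu.
  have [wx|xw] := leP w x; last first.
    by apply: right_free; [exact: ltW|case: wu => //; rewrite leNgt xw].
  by apply: left_free => //; case: tw => tw; lra.
pose psi y := tau (c y + a) y.
have hpsi y : h (psi y) = c y + a by rewrite (sq_htau H) //; lra.
have psiC y : C (psi y) y by apply: (levels_tau H); lra.
have cpsi : continuous psi.
  apply: (continuous_tau_line H (g := id)) => t; last exact: cvg_id.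
  by apply: cvgD; [exact: (sq_continuous H)|exact: cvg_cst].
(* Moving left along the slice, the upper boundary is met before [al]: otherwise the interval of [z]
   would contain [al], a point of [S]. *)
have gap_psi z : gap x z ->
    exists y y', [/\ al < y, y <= y', C z y', psi y = z & h z = c y + a].
  move=> xz; have [y' zy'] := levels_nonempty H z.
  have aly' : al < y'.
    by rewrite ltNge; apply/negP => y'al; apply: (xz y' zy' al) => //; right; lra.
  have mono t u : al <= t -> t <= u -> u <= y' -> c t <= c u.
    move=> alt tu uy'; have [tu'|ut] := ltP t u; last first.
      by have -> : t = u by apply/le_anti; rewrite tu.
    apply/ltW/incr => // w xw wu; apply: (xz y' zy'); left; lra.
  have [cy' _] := zy'.
  have cal : c al < h z - a.
    rewrite ltNge; apply/negP => hal; suff zal : C z al.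
      by apply: (xz al zal al) => //; right; lra.
    apply/(levelsP_left H zy' (ltW aly')) => t /andP[alt ty'].
    by have := mono _ _ (lexx al) alt ty'; have := mono _ _ alt ty' (lexx y'); lra.
  have [||y] := @IVT R c al y' (h z - a) (ltW aly').
  - by apply: continuous_subspaceT; exact: (sq_continuous H).
  - by rewrite ge_min le_max; apply/andP; split; apply/orP; [left|right]; lra.
  rewrite in_itv /= => /andP[aly yy'] cy.
  have {}aly : al < y.
    by rewrite lt_neqAle aly andbT; apply/eqP => e; move: cal; rewrite e cy ltxx.
  have zy : C z y.
    apply/(levelsP_left H zy' yy') => t /andP[yt ty'].
    have := mono _ _ (ltW aly) yt ty'.
    by have := mono _ _ (le_trans (ltW aly) yt) ty' (lexx y'); lra.
  by exists y, y'; split => //; [case: zy => _; rewrite /psi cy subrK|lra].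
have psi_left y y' : al < y -> c al < c y -> C (psi y) y' -> al < y'.
  move=> aly caly zy'; rewrite ltNge; apply/negP => y'al.
  have [cal _] : C (psi y) al by apply: (levels_convex H zy' (psiC y)); lra.
  by move: cal; rewrite hpsi; lra.
(* The gap unbounded to the right comes first and gives a half-line. *)
have [[s1 [Ss1 xs1]]|nright] := pselect (exists s, S s /\ x <= s); last first.
  have right_free w : x <= w -> ~ S w by move=> xw Sw; apply: nright; exists w.
  have {}incr t u : al <= t -> t < u -> c t < c u.
    by move=> alt tu; apply: incr => // w xw _; exact: right_free.
  have -> : gap x = (fun t => psi (al + t)) @` `]0, +oo[.
    apply/seteqP; split=> [z /gap_psi[y [y' [aly _ _ <- _]]]|_ [t + <-]].
      exists (y - al); first by rewrite /= in_itv /= andbT subr_gt0.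
      by rewrite addrC subrK.
    rewrite /= in_itv /= andbT => t0 y' zy' w xw.
    have aly' : al < y'.
      by apply: (psi_left (al + t)) => //; [lra|apply: incr; lra].
    have [wx|/ltW wx] := leP w x; last exact: right_free.
    by apply: left_free => //; move: xw; rewrite /between; lra.
  apply: (@arc_edge_image _ _ _ `[0, +oo[%classic); first by right.
  - move=> t; apply: continuous_comp; last exact: cpsi.
    by apply: cvgD; [exact: cvg_cst|exact: cvg_id].
  (* For closedness, the image is described as the classes of level at least [c al + a] that do not
     lie entirely to the left of [al]. *)
  - rewrite (_ : _ @` _ = ~` [set z | forall y, C z y -> y < al] `&`
        h @^-1` [set r | c al + a <= r]).
      apply: closedI.
        by apply: open_closedC; exact: (levels_lt_open H).
      apply: preimage_closed; last exact: closed_ge.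
      by move=> z _; exact: (sq_height H).
    apply/seteqP; split=> [_ [t + <-]|z [nlt /= hz]].
      rewrite /= in_itv /= andbT => t0; split.
        by move=> /(_ _ (psiC _)); lra.
      rewrite /= hpsi lerD2r; have [t1|t1] := ltP 0 t.
        by apply/ltW/incr; lra.
      by have -> : al + t = al by lra.
    have [zal|nzal] := pselect (C z al).
      exists 0; first by rewrite /= in_itv /= lexx.
      have [cal <-] := zal; rewrite addr0 /psi.
      by have -> : c al + a = h z by lra.
    have [y zy] : exists y, C z y /\ al <= y.
      apply: contrapT => ny; apply: nlt => y zy; rewrite ltNge.
      by apply/negP => aly; apply: ny; exists y.
    have [] : exists2 y, al < y & psi y = z; last first.
      move=> w alw <-; exists (w - al); last by rewrite addrC subrK.
      by rewrite /= in_itv /= andbT; lra.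
    have xz : gap x z.
      move=> y' zy' w xw.
      have aly' : al < y'.
        rewrite ltNge; apply/negP => y'al; apply: nzal.
        by apply: (levels_convex H zy' zy.1); rewrite y'al zy.2.
      have [wx|/ltW wx] := leP w x; last exact: right_free.
      by apply: left_free => //; move: xw; rewrite /between; lra.
    by have [w [_ [alw _ _ <- _]]] := gap_psi z xz; exists w.
  - move=> t u /=; rewrite !in_itv /= !andbT => t0 u0 tu.
    by rewrite !hpsi ltrD2r; apply: incr; lra.
have [be [[Sbe xbe] bemin]] : exists m, (S `&` [set s | x <= s]) m /\
    forall y, (S `&` [set s | x <= s]) y -> m <= y.
  apply: (@closed_min _ _ s1 x) => //.
  - by apply: closedI; [exact: (sq_closed H)|exact: closed_ge].
  - by move=> y [].
have {}xbe : x < be.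
  by rewrite lt_neqAle xbe andbT; apply/eqP => e; apply: nSx; rewrite e.
have right_free w : x <= w -> w < be -> ~ S w.
  by move=> xw wbe Sw; have := bemin w (conj Sw xw); rewrite leNgt wbe.
have {}incr t u : al <= t -> t < u -> u <= be -> c t < c u.
  move=> alt tu ube; apply: incr => // w xw wu; apply: right_free => //.
  exact: lt_le_trans ube.
have incrW t u : al <= t -> t <= u -> u <= be -> c t <= c u.
  move=> alt tu ube; have [tu'|ut] := ltP t u; first exact/ltW/incr.
  by have -> : t = u by apply/le_anti; rewrite tu.
have albe : al <= be by lra.
(* Otherwise [sq_gap] would place the whole interval from [al] to [be], hence also [x], in [S]. *)
have cab : c al + a < c be.
  rewrite ltNge; apply/negP => cab; apply: nSx.
  apply: (sq_gap H Sal Sbe); last by rewrite !ltW.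
  move=> t u /andP[alt tbe] /andP[alu ube].
  by have := incrW _ _ alt tbe (lexx be); have := incrW _ _ (lexx al) alu ube; lra.
(* At [ga] the upper boundary has level [c be], so the slice starting there reaches [be]. The
   classes starting before [ga] are exactly those of the gap. *)
have [||ga] := @IVT R c al be (c be - a) albe.
- by apply: continuous_subspaceT; exact: (sq_continuous H).
- by rewrite ge_min le_max; apply/andP; split; apply/orP; [left|right]; lra.
rewrite in_itv /= => /andP[alga gabe] cga.
have {}alga : al < ga.
  by rewrite lt_neqAle alga andbT; apply/eqP => e; move: cab; rewrite e cga; lra.
have ega : al + (ga - al) / 2 * 2 = ga by lra.
have -> : gap x = psi @` `]al, (al + (ga - al) / 2 * 2)[; last first.
  apply: arc_edge_segment => //; first lra.
  rewrite ega => t u alt tu uga; rewrite !hpsi ltrD2r; apply: incr => //; lra.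
rewrite ega; apply/seteqP; split=> [z xz|_ [y + <-]].
  have [y [y' [aly yy' zy' yz hz]]] := gap_psi z xz.
  exists y => //; rewrite /= in_itv /= aly /= ltNge; apply/negP => gay.
  have y'be : y' < be.
    by rewrite ltNge; apply/negP => bey'; apply: (xz y' zy' be) => //; left; lra.
  suff zbe : C z be by apply: (xz be zbe be) => //; left; lra.
  apply/(levelsP H zy' (ltW y'be)) => t /andP[y't tbe].
  have := incrW _ _ (ltW alga) gay (ltW (le_lt_trans yy' y'be)).
  have := incrW _ _ (le_trans (ltW aly) yy') y't tbe.
  have := incrW t be (le_trans (ltW aly) (le_trans yy' y't)) tbe (lexx be).
  by have [cy' _] := zy'; lra.
rewrite /= in_itv /= => /andP[aly yga] y' zy' w xw.
have caly : c al < c y by apply: incr => //; lra.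
have aly' := psi_left y y' aly caly zy'.
have y'be : y' < be.
  rewrite ltNge; apply/negP => bey'.
  have [cbe _] : C (psi y) be by apply: (levels_convex H (psiC y) zy'); lra.
  by have := incr y ga (ltW aly) yga gabe; move: cbe; rewrite hpsi; lra.
have [wx|/ltW wx] := leP w x.
  by apply: left_free => //; move: xw; rewrite /between; lra.
by apply: right_free => //; move: xw; rewrite /between; lra.
Qed.

End EdgeArcs.

(** * Sets with one to three elements *)

Section CardinalAtMostThree.
Context {U : Type}.
Implicit Types (A : set U) (x y z : U).

Lemma card_eq1_or_eq0 A x : A `<=` [set x] -> (A #= `I_0)%card \/ (A #= `I_1)%card.
Proof.
move=> Ax; have [->|->] := subset_set1 Ax; [left|right].
- by rewrite II0 card_eq0.
- exact: card_set1.
Qed.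

Lemma card_between1_3 A x y z : A x -> A `<=` [set x; y; z] ->
  [\/ (A #= `I_1)%card, (A #= `I_2)%card | (A #= `I_3)%card].
Proof.
move=> Ax Axyz; have step (B : set U) n u : B u -> (B `\ u #= `I_n)%card ->
  (B #= `I_n.+1)%card by move=> Bu Bn; apply/eq_cardSP; exists u.
have [Ay|nAy] := pselect ((A `\ x) y).
  have sub : (A `\ x) `\ y `<=` [set z].
    move=> w [[/Axyz wxyz nwx] nwy].
    by case: wxyz => [[wx|wy]|//]; [case: nwx|case: nwy].
  have [e|e] := card_eq1_or_eq0 sub; [apply: Or32|apply: Or33].
    exact: (step A 1%N x Ax (step _ 0%N y Ay e)).
  exact: (step A 2%N x Ax (step _ 1%N y Ay e)).
have sub : A `\ x `<=` [set z].
  move=> w [Aw nwx]; case: (Axyz w Aw) => [[wx|wy]|//]; first by case: nwx.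
  by exfalso; apply: nAy; rewrite -wy.
have [e|e] := card_eq1_or_eq0 sub; [apply: Or31|apply: Or32].
  exact: (step A 0%N x Ax e).
exact: (step A 1%N x Ax e).
Qed.

End CardinalAtMostThree.

(** * Graph structure, degrees and local extrema *)

Section ReebGraphOfStrip.
Context {R : realType} {T : topologicalType}.

(** If [c] decreases on the gap, the flipped strip has an increasing lower boundary and the same gap
    edge, with height [\- h]. *)
Lemma gap_arc_of_left c a S h tau x : @strip_quotient R T c a S h tau ->
  ~ S x -> (exists2 s, S s & s < x) ->
  arc_edge h (gap_edge c a S h tau x) \/ arc_edge (\- h) (gap_edge c a S h tau x).
Proof.
move=> H nSx Ss; have [inc|dec] := gap_direction H x.
  by left; exact: (gap_arc_left H).
right; have := gap_arc_left (strip_quotient_flip H) nSx _ Ss.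
rewrite (_ : gap_edge _ _ _ (\- h) _ _ = gap_edge c a S h tau x).
  by apply=> t u tu /(dec t u tu) /=; lra.
apply/seteqP; split=> z xz y zy; apply: xz; move: zy; rewrite /levels /= opprK;
  move=> [zy ->]; split => //; lra.
Qed.

(** Since [S] is non-empty, the gap has an end on some side; a right end becomes a left end under
    reflection. *)
Lemma gap_arc c a S h tau x : @strip_quotient R T c a S h tau ->
  ~ S x -> S !=set0 ->
  arc_edge h (gap_edge c a S h tau x) \/ arc_edge (\- h) (gap_edge c a S h tau x).
Proof.
move=> H nSx [s Ss]; have [sx|] := ltP s x.
  by apply: gap_arc_of_left => //; exists s.
rewrite le_eqVlt => /predU1P[xs|xs]; first by rewrite xs in nSx.
have := @gap_arc_of_left _ _ _ _ _ (- x) (strip_quotient_reflect H).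
rewrite (_ : gap_edge _ _ _ _ _ (- x) = gap_edge c a S h tau x).
  by rewrite /= opprK; apply => //; exists (- s); rewrite /= ?opprK // ltrN2.
apply/seteqP; split=> z xz y zy t xt.
  have := xz (- y); rewrite /levels /= opprK => /(_ zy (- t)); rewrite opprK.
  by apply; move: xt; rewrite /between; lra.
by apply: (xz (- y) zy (- t)); move: xt; rewrite /between; lra.
Qed.

Context {c : R -> R} {a : R} {S : set R} {h : T -> R} {tau : R -> R -> T}.
Hypothesis H : strip_quotient c a S h tau.
Hypothesis S0 : S !=set0.
Local Notation C := (levels c a h tau).
Local Notation piece := (piece_edge c a h tau).
Local Notation gap := (gap_edge c a S h tau).
Local Notation E := (strip_edges c a S h tau).
Local Notation V := (strip_vertices c a S h tau).
Local Notation star := (star c a S h tau).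

Lemma edge_arc e : E e -> arc_edge h e \/ arc_edge (\- h) e.
Proof.
move=> [[s Ss ->]|[x nSx ->]]; last exact: gap_arc.
by left; exact: (piece_arc H).
Qed.

Lemma continuousN_height : continuous (\- h).
Proof. by move=> z; apply: cvgN; exact: (sq_height H). Qed.

(** Over [s] the level is moved slightly towards the middle [c s + a / 2] of the strip. *)
Lemma closure_piece s z : C z s -> closure (piece s) z.
Proof.
move=> [hz zs] W; have ctau : continuous (tau ^~ s).
  by apply: (continuous_tau_line H (f := id) (g := fun=> s)) => t;
    [exact: cvg_id|exact: cvg_cst].
rewrite -{1}zs => /(ctau (h z))/nbhs_ballP[d /= d0 dW].
pose e := Num.min (d / a) (1 / 2); have a0 := sq_width H.
have e0 : 0 < e by rewrite lt_min divr_gt0 //=; lra.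
have e1 : e < 1 by rewrite gt_min; apply/orP; right; lra.
have ed : e * a <= d by rewrite -ler_pdivlMr // ge_min lexx.
pose q := h z + e * (c s + a / 2 - h z).
have qs : c s < q < c s + a by rewrite /q; nra.
have qs' : c s <= q <= c s + a by lra.
exists (tau q s); split.
  by split; [exact: (levels_tau H)|rewrite (sq_htau H)].
by apply: dW; rewrite /ball /= /q ltr_distlC; nra.
Qed.

Lemma edges_cover_closure : \bigcup_(e in E) closure e = [set: T].
Proof.
apply/seteqP; split=> // z _; have : [set: T] z by [].
rewrite -(edges_cover H) => -[[s [Ss zs _]]|[e Ee ez]].
  by exists (piece s); [left; exists s|exact: closure_piece].
by exists e => //; exact: subset_closure.
Qed.

Lemma strip_graph : graph_with_ends (R := R) V E.
Proof.
have locfin x := edges_locally_finite H x.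
have locfin' (x : T) : exists2 U : set T, nbhs x U &
    finite_set [set e | E e /\ closure e `&` U !=set0].
  by have [U xU [_ finU]] := locfin x; exists U.
have [s Ss] := S0; split.
- exact: (strip_quotient_hausdorff H).
- exact: (strip_quotient_connected H).
- apply: (locally_finite_locally_compact edges_cover_closure locfin').
    exact: (strip_quotient_hausdorff H).
  move=> e z /edge_arc[|]; apply: arc_edge_local_compact.
    exact: (sq_height H).
  exact: continuousN_height.
- by exists (piece s); left; exists s.
- exact: (edges_cover H).
- exact: (edges_disjoint H).
- exact: (edges_vertices H).
- exact: (edges_boundary H).
- move=> e /edge_arc[|]; apply: arc_edge_type; first exact: (sq_height H).
  exact: continuousN_height.
- exact: (locally_finite_closed edges_cover_closure locfin').
- exact: locfin.
Qed.

Lemma strip_oriented : oriented_by h V E.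
Proof.
apply: oriented_by_edges; first exact: (edges_vertices H).
move=> e /edge_arc[|] arc; first exact: (arc_edge_oriented arc).
by apply: oriented_edgeN; exact: (arc_edge_oriented arc).
Qed.

(** The edge [piece s] is incident to the vertex, and the star leaves at most two further edges. *)
Lemma strip_degree z : V z ->
  [\/ has_degree E z 1, has_degree E z 2 | has_degree E z 3].
Proof.
move=> [s [Ss zs _]]; have [eL [eR LR]] := star_edges H Ss.
apply: (@card_between1_3 _ _ (piece s) eL eR).
  by split; [left; exists s|exact: closure_piece].
move=> e [Ee ez].
have [|->|->|->] := LR e Ee; [|by left; left|by left; right|by right].
by exists z; split => //; exact: (levels_star H).
Qed.

Lemma strip_extremum z : V z -> local_extremum h z -> has_degree E z 1.
Proof.
move=> [s [Ss zs hz]] ext; have a0 := sq_width H.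
have zstar : \forall w \near z, star s w.
  by apply: open_nbhs_nbhs; split; [exact: (star_open H)|exact: (levels_star H)].
have pz := closure_piece zs.
have height : \forall w \near z, c s <= h w <= c s + a.
  (* The edge [piece s] approaches [z] from strictly between the two boundary levels, so a vertex at
     level [c s] can only be a minimum and one at level [c s + a] only a maximum. *)
  case: hz => hz; case: ext => ext.
  - by have [w [[_ hw] /=]] := pz _ ext; lra.
  - have up : \forall w \near z, h w < c s + a.
      by apply: (near_lt (sq_height H)); lra.
    by apply: filterS2 ext up => w; lra.
  - have lo : \forall w \near z, c s < h w.
      by apply: (near_gt (sq_height H)); lra.
    by apply: filterS2 ext lo => w; lra.
  - by have [w [[_ hw] /=]] := pz _ ext; lra.
rewrite /has_degree (_ : [set e | _] = [set piece s]); first exact: card_set1.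
apply/seteqP; split=> [e [Ee ez]|_ ->]; last first.
  by split; [left; exists s|exact: closure_piece].
have [w [ew [ws hw]]] := ez _ (filterI zstar height).
have ws' : C w s by exact: (star_level H).
case: Ee ew {ez} => [[s' Ss' ->] [ws'' _]|[x nSx ->] xw].
  exact: (piece_inj H Ss' Ss (levels_piece H Ss' Ss ws'' ws')).
by exfalso; apply: (xw s ws' s) => //; rewrite /between; lra.
Qed.

End ReebGraphOfStrip.

(** * Contours of the hypersurface *)

Lemma continuous_rV (R : realType) (n : nat) (T : topologicalType)
    (g : T -> 'rV[R]_n) :
  (forall i, continuous (fun t => g t ord0 i)) -> continuous g.
Proof.
move=> cg t A [P gP PA].
have : \forall u \near t, forall i, P ord0 i (g u ord0 i).
  apply: (@filter_forall _ _ (fun i u => P ord0 i (g u ord0 i))) => i.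
  exact: (cg i t _ (gP ord0 i)).
by apply: filterS => u Pu; apply: PA => i j; rewrite (ord1 i).
Qed.

(** The path is lifted to the subtype [X] by [insubd], whose default [p] is taken only where [g]
    leaves [X]. The lift is continuous because [X] carries the initial topology. *)
Lemma contour_path (R : realType) (n : nat) (X : set 'rV[R]_n)
    (f : 'rV[R]_n -> R) (g : R -> 'rV[R]_n) (s t : R) (p p' : X) :
  s <= t -> {within `[s, t], continuous g} ->
  (forall u, s <= u <= t -> X (g u) /\ f (g u) = f (g s)) ->
  set_val p = g s -> set_val p' = g t -> contour (sigL X f) p p'.
Proof.
move=> st cg gX ps pt; pose G u : X := insubd p (g u).
have GE u : s <= u <= t -> set_val (G u) = g u.
  by move=> /gX[Xu _]; rewrite /G; apply: insubdK; exact/mem_set.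
have cG : {within `[s, t], continuous G}.
  apply: (@continuous_comp_initial _ (subspace `[s, t]%classic) _ set_val).
  apply: (subspace_eq_continuous _ cg) => u /set_mem.
  by rewrite /= in_itv /= => /GE ->.
have Gp : p = G s by apply: val_inj; rewrite [RHS]GE // lexx.
have Gp' : p' = G t by apply: val_inj; rewrite [RHS]GE // lexx st.
apply: (@connected_component_max _ _ (G @` `[s, t])).
- by exists s => //=; rewrite in_itv /= lexx.
- move=> _ [u su <-]; have {}su : s <= u <= t by move: su; rewrite /= in_itv.
  have [_ e] := gX u su; rewrite /preimage /sigL /=.
  by rewrite [set_val (G u)]GE // [set_val p]ps.
- apply: connected_continuous_connected cG.
  by apply/connected_intervalP; exact: interval_is_interval.
- by exists t => //=; rewrite in_itv /= lexx st.
Qed.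

(** * Coordinates on the hypersurface *)

Section Clamp.
Context {R : realType} (c : R -> R) (a : R).

Definition clamp (q x : R) : R := Num.max (c x) (Num.min q (c x + a)).

Hypothesis a0 : 0 < a.

Lemma clamp_strip q x : c x <= clamp q x <= c x + a.
Proof.
by rewrite /clamp le_max lexx /= ge_max ge_min lexx orbT andbT lerDl ltW.
Qed.

Lemma clamp_id q x : c x <= q <= c x + a -> clamp q x = q.
Proof. by move=> /andP[cq qc]; rewrite /clamp (min_idPl qc) (max_idPr cq). Qed.

Lemma continuous_clamp (T : topologicalType) (f g : T -> R) : continuous c ->
  continuous f -> continuous g -> continuous (fun t => clamp (f t) (g t)).
Proof.
move=> cc cf cg t; have ccg : {for t, continuous (c \o g)}.
  by apply: continuous_comp; [exact: cg|exact: cc].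
apply: (@continuous_max _ _ (c \o g) (fun t => Num.min (f t) (c (g t) + a))) => //.
apply: (@continuous_min _ _ f (fun t => c (g t) + a)); first exact: cf.
by apply: cvgD; [exact: ccg|exact: cvg_cst].
Qed.

(** Continuation argument: at a first abscissa where strictness fails, the weak inequalities still
    hold by continuity, and the hypothesis makes them strict there. *)
Lemma strict_level_right q x : continuous c -> c x <= q <= c x + a ->
  (forall t, x <= t -> (forall u, x <= u <= t -> c u <= q <= c u + a) ->
    c t < q < c t + a) ->
  forall t, x <= t -> c t < q < c t + a.
Proof.
move=> cc cx strict t0 xt0; apply: contrapT => nt0.
pose A := [set t | x <= t] `&` ~` [set t | c t < q < c t + a].
have cA : closed A.
  apply: closedI; first exact: closed_ge.
  apply: open_closedC.
  rewrite (_ : [set t | _] = c @^-1` `](q - a), q[%classic).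
    by apply: open_comp; [move=> ? _; exact: cc|exact: interval_open].
  by apply/seteqP; split=> t; rewrite /= in_itv /=; lra.
have [t1 [[/= xt1 nt1] t1min]] : exists t, A t /\ forall u, A u -> t <= u.
  by apply: (closed_min (b := x) cA (conj xt0 nt0)) => u [].
apply: nt1; apply: strict => // u /andP[xu ut1].
have before w : x <= w -> w < t1 -> c w < q < c w + a.
  move=> xw wt1; apply: contrapT => nw.
  by have := t1min w (conj xw nw); rewrite leNgt wt1.
have [ut|tu] := ltP u t1; first by have := before u xu ut; lra.
have {u xu ut1 tu} -> : u = t1 by apply/le_anti; rewrite ut1.
have [xt|tx] := ltP x t1; last by have <- : x = t1 by apply/le_anti; rewrite xt1.
have cB : closed [set t | c t <= q <= c t + a].
  rewrite (_ : [set t | _] = c @^-1` `[q - a, q]%classic).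
    by apply: preimage_closed; [move=> ? _; exact: cc|exact: itv_closed].
  by apply/seteqP; split=> t; rewrite /= in_itv /=; lra.
apply: cB => W /nbhs_ballP[d /= d0 dW]; pose w := Num.max x (t1 - d / 2).
have xw : x <= w by rewrite le_max lexx.
have wt : w < t1 by rewrite gt_max xt /=; lra.
have tw : t1 - d / 2 <= w by rewrite le_max lexx orbT.
exists w; split; first by have := before w xw wt; rewrite /=; lra.
by apply: dW; rewrite /ball /= ltr_distlC; lra.
Qed.

End Clamp.

Section HypersurfacePoints.
Context {R : realType} (m : nat) (c : R -> R) (a : R).
Hypotheses (hm : (2 <= m)%N) (cc : continuous c) (a0 : 0 < a).
Local Notation X := (hypersurface m c (fun x => c x + a)).
Implicit Types (w : 'I_m.+1 -> R) (p : 'rV[R]_m.+1).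

Definition sqnorm w : R := \sum_(i < m.+1 | (2 <= i)%N) w i ^+ 2.

Definition strip_radius (k x : R) : R := Num.sqrt ((k - c x) * (c x + a - k)).

(** The point over level [q] and abscissa [x] in the direction [w] of the sphere fibre. Clamping [q]
    keeps it on the hypersurface for all [q] and [x] when [w] is a unit vector. *)
Definition strip_point w (q x : R) : 'rV[R]_m.+1 :=
  \row_(i < m.+1) if i == 0%N :> nat then clamp c a q x else
    if i == 1%N :> nat then x else strip_radius (clamp c a q x) x * w i.

Lemma sqnorm_ge0 w : 0 <= sqnorm w.
Proof. by apply: sumr_ge0 => i _; exact: sqr_ge0. Qed.

Lemma strip_ge0 k x : c x <= k <= c x + a -> 0 <= (k - c x) * (c x + a - k).
Proof. by move=> kx; apply: mulr_ge0; lra. Qed.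

Lemma coord1_strip_point w q x : coord1 (strip_point w q x) = clamp c a q x.
Proof. by rewrite /coord1 mxE. Qed.

Lemma coord2_strip_point w q x : coord2 (strip_point w q x) = x.
Proof. by rewrite /coord2 mxE inordK // ltnS (leq_trans _ hm). Qed.

Lemma closure_strip q x : c x <= q <= c x + a ->
  closure (strip c (fun x => c x + a)) (q, x).
Proof.
move=> qx W; pose g (t : R) : R * R := (q + t * (c x + a / 2 - q), x).
have cg : continuous g.
  apply: continuous_pair => t; last exact: cvg_cst.
  apply: cvgD; first exact: cvg_cst.
  by apply: cvgM; [exact: cvg_id|exact: cvg_cst].
have g0 : g 0 = (q, x) by rewrite /g mul0r addr0.
rewrite -g0 => /(cg 0)/nbhs_ballP[d /= d0 dW].
pose e := Num.min (d / 2) (1 / 2).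
have e0 : 0 < e by rewrite lt_min; apply/andP; split; lra.
have ed : e < d by rewrite gt_min; apply/orP; left; lra.
have e1 : e < 1 by rewrite gt_min; apply/orP; right; lra.
exists (g e); split; first by have := a0; rewrite /strip /g /=; nra.
by apply: dW; rewrite /ball /= ltr_distlC; lra.
Qed.

(** The two factors have a non-negative product and the positive sum [a], so both are
    non-negative. *)
Lemma hypersurface_strip p : X p ->
  c (coord2 p) <= coord1 p <= c (coord2 p) + a.
Proof.
move=> [_ /eqP]; rewrite subr_eq0 => /eqP e.
have := sqnorm_ge0 (p ord0); have := a0; rewrite /sqnorm -e; nra.
Qed.

Lemma hypersurfaceP p : X p <-> c (coord2 p) <= coord1 p <= c (coord2 p) + a /\
  sqnorm (p ord0) = (coord1 p - c (coord2 p)) * (c (coord2 p) + a - coord1 p).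
Proof.
split=> [Xp|[st e]].
  split; first exact: hypersurface_strip.
  by case: Xp => _ /eqP; rewrite subr_eq0 => /eqP ->.
by split; [exact: closure_strip|apply/eqP; rewrite subr_eq0 -e].
Qed.

Lemma strip_point_hypersurface w q x : sqnorm w = 1 -> X (strip_point w q x).
Proof.
move=> w1; apply/hypersurfaceP; rewrite coord1_strip_point coord2_strip_point.
have st := clamp_strip c a0 q x; split => //.
rewrite -[RHS]sqr_sqrtr ?strip_ge0 // -/(strip_radius _ _) -[RHS]mulr1 -w1 /sqnorm.
rewrite mulr_sumr; apply: eq_bigr => i i2; rewrite mxE -exprMn.
by case: (val i) i2 => [|[]].
Qed.

Definition axis2 : 'I_m.+1 -> R := fun i => (i == 2%N :> nat)%:R.

Lemma sqnorm_axis k : (2 <= k <= m)%N ->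
  sqnorm (fun i => (i == k :> nat)%:R) = 1.
Proof.
move=> /andP[k2 km]; rewrite /sqnorm (bigD1 (inord k)) /= inordK ?ltnS //.
rewrite eqxx expr1n big1 ?addr0 // => i /andP[_ ik].
case: eqP => [e|_]; last by rewrite expr0n.
by exfalso; move/eqP: ik; apply; apply: val_inj; rewrite /= inordK ?ltnS.
Qed.

Lemma sqnorm_axis2 : sqnorm axis2 = 1.
Proof. by apply: sqnorm_axis; rewrite hm. Qed.

Lemma sqnormZ k w : sqnorm (fun i => k * w i) = k ^+ 2 * sqnorm w.
Proof. by rewrite /sqnorm mulr_sumr; apply: eq_bigr => i _; rewrite exprMn. Qed.

Lemma sqnorm_eq0 w : sqnorm w = 0 -> forall i : 'I_m.+1, (2 <= i)%N -> w i = 0.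
Proof.
move=> /eqP; rewrite psumr_eq0; last by move=> i _; exact: sqr_ge0.
move=> /allP w0 i i2; have := w0 i (mem_index_enum i).
by rewrite i2 sqrf_eq0 => /eqP.
Qed.

Lemma hypersurface_point p : X p ->
  exists2 w, sqnorm w = 1 & p = strip_point w (coord1 p) (coord2 p).
Proof.
move=> /hypersurfaceP[st e].
pose r := strip_radius (coord1 p) (coord2 p).
have r2 : r ^+ 2 = sqnorm (p ord0) by rewrite sqr_sqrtr ?strip_ge0 // e.
have split_coord w : (forall i : 'I_m.+1, (2 <= i)%N -> p ord0 i = r * w i) ->
    p = strip_point w (coord1 p) (coord2 p).
  move=> pw; apply/rowP => i; rewrite mxE clamp_id //.
  have [i0|i0] := eqVneq (i : nat) 0%N; first by congr (p _ _); apply: val_inj.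
  have [i1|i1] := eqVneq (i : nat) 1%N.
    by congr (p _ _); apply: val_inj; rewrite /= inordK // ltnS (leq_trans _ hm).
  have i2 : (2 <= i)%N by case: (i : nat) i0 i1 => [|[]].
  exact: pw.
(* Over the boundary of the strip the fibre is one point and any unit direction represents it. *)
have [r0|r0] := eqVneq r 0.
  exists axis2; first exact: sqnorm_axis2.
  apply: split_coord => i i2; rewrite r0 mul0r.
  by apply: (sqnorm_eq0 _ i2); rewrite -r2 r0 expr0n.
exists (fun i => r^-1 * p ord0 i).
  by rewrite sqnormZ -r2 exprVn mulVf // expf_neq0.
by apply: split_coord => i _; rewrite mulVKf.
Qed.

Lemma strip_point_boundary w w' q x : (q - c x) * (c x + a - q) = 0 ->
  strip_point w q x = strip_point w' q x.
Proof.
move=> e; have st : c x <= q <= c x + a.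
  by move/eqP: e; rewrite mulf_eq0 => /orP[]/eqP; have := a0; lra.
by apply/rowP => i; rewrite !mxE clamp_id // /strip_radius e sqrtr0 !mul0r.
Qed.

Lemma continuous_strip_point (T : topologicalType) (w : T -> 'I_m.+1 -> R)
    (f g : T -> R) : (forall i, continuous (w ^~ i)) -> continuous f ->
  continuous g -> continuous (fun t => strip_point (w t) (f t) (g t)).
Proof.
move=> cw cf cg; have cclamp := continuous_clamp (a := a) cc cf cg.
apply: continuous_rV => i.
rewrite (_ : (fun t => _) = if i == 0%N :> nat
    then (fun t => clamp c a (f t) (g t)) else if i == 1%N :> nat then g
    else (fun t => strip_radius (clamp c a (f t) (g t)) (g t) * w t i)); last first.
  by apply/funext => t; rewrite mxE; case: ifP => // _; case: ifP.
case: ifP => // _; case: ifP => // _ t; apply: cvgM; last exact: cw.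
have cgt : c (g u) @[u --> t] --> c (g t).
  by apply: continuous_comp; [exact: cg|exact: cc].
rewrite /strip_radius; set k := fun u => clamp c a (f u) (g u).
apply: (@continuous_comp _ R R
  (fun u => (k u - c (g u)) * (c (g u) + a - k u)) Num.sqrt t); last first.
  exact: sqrt_continuous.
apply: cvgM; first by apply: cvgB => //; exact: cclamp.
by apply: cvgB; [apply: cvgD => //; exact: cvg_cst|exact: cclamp].
Qed.

End HypersurfacePoints.

(** * Contours as components of slices of the strip *)

Section HypersurfaceContours.
Context {R : realType} (m : nat) (c : R -> R) (a : R).
Hypotheses (hm : (2 <= m)%N) (cc : continuous c) (a0 : 0 < a).
Local Notation X := (hypersurface m c (fun x => c x + a)).
Local Notation f := (sigL X coord1).
Local Notation point := (@strip_point R m c a).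
Implicit Types (w : 'I_m.+1 -> R) (p : X).

Definition dot w w' : R := \sum_(i < m.+1 | (2 <= i)%N) w i * w' i.

Lemma sqnormD s t w w' : sqnorm (fun i => s * w i + t * w' i) =
  s ^+ 2 * sqnorm w + 2 * s * t * dot w w' + t ^+ 2 * sqnorm w'.
Proof.
rewrite /sqnorm /dot !mulr_sumr -!big_split /=; apply: eq_bigr => i _; ring.
Qed.

Lemma dot_axis k w : (2 <= k <= m)%N ->
  dot w (fun i => (i == k :> nat)%:R) = w (inord k).
Proof.
move=> /andP[k2 km]; rewrite /dot (bigD1 (inord k)) /= inordK ?ltnS //.
rewrite eqxx mulr1 big1 ?addr0 // => i /andP[_ ik].
case: eqP => [e|_]; last by rewrite mulr0.
by exfalso; move/eqP: ik; apply; apply: val_inj; rewrite /= inordK ?ltnS.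
Qed.

Lemma dotC w w' : dot w w' = dot w' w.
Proof. by apply: eq_bigr => i _; rewrite mulrC. Qed.

Lemma dot_le1 w w' : sqnorm w = 1 -> sqnorm w' = 1 -> -1 <= dot w w' <= 1.
Proof.
move=> w1 w'1.
have := sqnorm_ge0 (fun i => 1 * w i + 1 * w' i).
have := sqnorm_ge0 (fun i => 1 * w i + (-1) * w' i).
by rewrite !sqnormD w1 w'1; lra.
Qed.

Lemma contour_line w q x x' p p' :  sqnorm w = 1 ->
  set_val p = point w q x -> set_val p' = point w q x' ->
  (forall t, between x x' t -> c t <= q <= c t + a) -> contour f p p'.
Proof.
suff line y y' (s s' : X) : sqnorm w = 1 -> y <= y' ->
    set_val s = point w q y -> set_val s' = point w q y' ->
    (forall t, y <= t <= y' -> c t <= q <= c t + a) -> contour f s s'.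
  move=> w1 px px' st; have [xx'|/ltW x'x] := leP x x'.
    by apply: (line _ _ _ _ w1 xx' px px') => t xt; apply: st; left.
  apply: contour_sym; apply: (line _ _ _ _ w1 x'x px' px) => t xt.
  by apply: st; right.
move=> w1 yy' sy sy' st.
apply: (contour_path (g := fun u => point w q u) yy') => //.
  apply: continuous_subspaceT; apply: continuous_strip_point => //.
  - by move=> i t; exact: cvg_cst.
  - by move=> t; exact: cvg_cst.
  - by move=> t; exact: cvg_id.
move=> u yu; split; first exact: strip_point_hypersurface.
by rewrite !coord1_strip_point !clamp_id //; apply: st; rewrite ?lexx ?yy'.
Qed.

(** The segment from [w] to [w'] avoids the origin unless they are antipodal, so it can be
    normalized to a path of unit vectors. *)
Lemma contour_rotate_segment w w' q x p p' : sqnorm w = 1 -> sqnorm w' = 1 ->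
  dot w w' != -1 -> set_val p = point w q x -> set_val p' = point w' q x ->
  contour f p p'.
Proof.
move=> w1 w'1 ww' pw pw'; have dle := dot_le1 w1 w'1.
have dgt : -1 < dot w w' by rewrite lt_neqAle eq_sym ww'; lra.
pose n (t : R) := (1 - t) * (1 - t) + 2 * (1 - t) * t * dot w w' + t * t.
have nE t : sqnorm (fun i => (1 - t) * w i + t * w' i) = n t.
  by rewrite sqnormD w1 w'1 !mulr1 !expr2.
have n0 t : 0 < n t.
  (* In this form the first term is non-negative and the second is positive. *)
  have -> : n t = ((1 - 2 * t) ^+ 2 * (1 - dot w w') + (1 + dot w w')) / 2.
    by rewrite /n; field.
  have : 0 <= (1 - 2 * t) ^+ 2 * (1 - dot w w').
    by apply: mulr_ge0; [exact: sqr_ge0|lra].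
  lra.
pose g (t : R) (i : 'I_m.+1) := (Num.sqrt (n t))^-1 * ((1 - t) * w i + t * w' i).
have g1 t : sqnorm (g t) = 1.
  by rewrite sqnormZ nE exprVn sqr_sqrtr ?mulVf ?gt_eqF // ltW.
have g_0 : g 0 = w.
  apply/funext => i; rewrite /g (_ : n 0 = 1); last by rewrite /n; ring.
  by rewrite sqrtr1 invr1 subr0 mul0r addr0 !mul1r.
have g_1 : g 1 = w'.
  apply/funext => i; rewrite /g (_ : n 1 = 1); last by rewrite /n; ring.
  by rewrite sqrtr1 invr1 subrr mul0r add0r !mul1r.
have cid (t : R) : (u : R) @[u --> t] --> t by exact: cvg_id.
have csub (t : R) : 1 - u @[u --> t] --> 1 - t.
  by apply: cvgB; [exact: cvg_cst|exact: cid].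
have cn : continuous n.
  move=> t; apply: cvgD; last by apply: cvgM; exact: cid.
  apply: cvgD; first by apply: cvgM; exact: csub.
  apply: cvgM; last exact: cvg_cst.
  by apply: cvgM; [apply: cvgM; [exact: cvg_cst|exact: csub]|exact: cid].
apply: (contour_path (g := fun u => point (g u) q x) ler01).
- apply: continuous_subspaceT; apply: continuous_strip_point => //.
  + move=> i t; apply: cvgM.
      apply: cvgV; first by rewrite sqrtr_eq0 -ltNge.
      apply: (@continuous_comp _ R R n Num.sqrt); first exact: cn.
      exact: sqrt_continuous.
    by apply: cvgD; [apply: cvgM; [exact: csub|exact: cvg_cst]|
                     apply: cvgM; [exact: cid|exact: cvg_cst]].
  + by move=> t; exact: cvg_cst.
  + by move=> t; exact: cvg_cst.
- move=> u u1; split; first exact: strip_point_hypersurface.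
  by rewrite !coord1_strip_point.
- by rewrite g_0.
- by rewrite g_1.
Qed.

Definition unit_point w (w1 : sqnorm w = 1) q x : X :=
  SigSub (mem_set (strip_point_hypersurface c hm a0 q x w1)).

Lemma contour_trans p1 p2 p3 : contour f p1 p2 -> contour f p2 p3 ->
  contour f p1 p3.
Proof.
by move=> /reeb_map_eqP e12 /reeb_map_eqP e23; apply/reeb_map_eqP; rewrite e12.
Qed.

(* Antipodal directions are joined through a coordinate axis. *)
Lemma contour_rotate_sphere w w' q x p p' : (3 <= m)%N ->
  sqnorm w = 1 -> sqnorm w' = 1 ->
  set_val p = point w q x -> set_val p' = point w' q x -> contour f p p'.
Proof.
move=> m3 w1 w'1 pw pw'; have [d1|] := eqVneq (dot w w') (-1); last first.
  by move=> d1; exact: contour_rotate_segment pw pw'.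
have w'E (i : 'I_m.+1) : (2 <= i)%N -> w' i = - w i.
  move=> i2; have : sqnorm (fun i => 1 * w i + 1 * w' i) = 0.
    by rewrite sqnormD w1 w'1 d1; ring.
  by move=> /sqnorm_eq0/(_ i i2); rewrite !mul1r; lra.
(* Two coordinates of a unit vector cannot both have square 1, so one of the axes 2 and 3 is neither
   [w] nor its antipode. *)
have [k [k2 km kw]] : exists k, [/\ (2 <= k)%N, (k <= m)%N & w (inord k) ^+ 2 != 1].
  have [w2|w2] := eqVneq (w (inord 2) ^+ 2) 1; last by exists 2%N.
  exists 3%N; split => //; apply/eqP => w3.
  have : sqnorm w >= w (inord 2) ^+ 2 + w (inord 3) ^+ 2.
    rewrite /sqnorm (bigD1 (inord 2)) /=; last by rewrite inordK ?ltnS.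
    rewrite lerD2l.
    rewrite (bigD1 (inord 3)) /=; last first.
      rewrite inordK ?ltnS //=; apply/eqP => /(congr1 val) /=.
      by rewrite !inordK ?ltnS.
    by rewrite lerDl; apply: sumr_ge0 => i _; exact: sqr_ge0.
  by rewrite w1 w2 w3; lra.
have kk : (2 <= k <= m)%N by rewrite k2.
have e1 := @sqnorm_axis R m k kk.
pose p'' := unit_point e1 q x.
have kw1 : w (inord k) != -1 by apply: contraNneq kw => ->; rewrite sqrrN expr1n.
have kw2 : w (inord k) != 1 by apply: contraNneq kw => ->; rewrite expr1n.
have pp'' : contour f p p''.
  by apply: (contour_rotate_segment w1 e1 _ pw) => //; rewrite dot_axis.
apply: contour_trans pp'' _; apply: (contour_rotate_segment e1 w'1 _ _ pw') => //.
by rewrite dotC dot_axis // w'E ?inordK ?ltnS // eqr_opp.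
Qed.

Hypothesis hline :
  m = 2%N -> ~ exists q, forall t, strip c (fun x => c x + a) (q, t).

(* The two directions are joined over a point of the boundary of the strip if the
   level reaches one, and otherwise, for m >= 3, within a sphere. *)
Lemma contour_rotate w w' q x p p' : c x <= q <= c x + a ->
  sqnorm w = 1 -> sqnorm w' = 1 ->
  set_val p = point w q x -> set_val p' = point w' q x -> contour f p p'.
Proof.
move=> qx w1 w'1 pw pw'.
have [[t [xt bt]]|nt] := pselect (exists t,
    (forall u, between x t u -> c u <= q <= c u + a) /\
    (q - c t) * (c t + a - q) = 0).
  have pt := contour_line w1 pw (erefl (set_val (unit_point w1 q t))) xt.
  have pt' := contour_line w'1 pw' (erefl (set_val (unit_point w'1 q t))) xt.
  apply: contour_trans pt _; apply: contour_sym.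
  rewrite (_ : unit_point w1 q t = unit_point w'1 q t) //.
  by apply: val_inj; exact: (strip_point_boundary a0).
have strict t : (forall u, between x t u -> c u <= q <= c u + a) ->
    c t < q < c t + a.
  move=> xt; have qt : c t <= q <= c t + a by apply: xt; rewrite /between; lra.
  apply: contrapT => nq; apply: nt; exists t; split => //.
  have /andP[] := qt; rewrite le_eqVlt => /predU1P[<-|cq].
    by rewrite subrr mul0r.
  rewrite le_eqVlt => /predU1P[->|qc]; first by rewrite subrr mulr0.
  by case: nq; rewrite cq.
(* The slice never meets the boundary, so strictness propagates to the right of [x] and, by
   reflection, to the left. *)
have allt t : c t < q < c t + a.
  have [xt|tx] := leP x t.
    apply: (strict_level_right cc qx) xt => u xu ut; apply: strict => v xv.
    by apply: ut; move: xv; rewrite /between; lra.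
  have cc' : continuous (c \o -%R).
    by move=> y; apply: continuous_comp; [exact: opp_continuous|exact: cc].
  have := @strict_level_right _ (c \o -%R) a q (- x) cc'.
  rewrite /= opprK => /(_ qx _ (- t)); rewrite opprK.
  apply; last by rewrite lerN2 ltW.
  move=> u xu ut; apply: strict => v xv.
  have := ut (- v); rewrite opprK; apply.
  by move: xv; rewrite /between; lra.
apply: contour_rotate_sphere pw pw' => //.
(* A whole line lies in the strip, which [hline] excludes for [m = 2]; hence the spheres are
   connected. *)
rewrite ltn_neqAle hm andbT; apply/eqP => m2; apply: (hline (esym m2)).
by exists q => t; exact: allt.
Qed.

(** A contour projects onto an interval of abscissas inside the slice. Conversely, [p] is moved
    along the slice to the abscissa of [p'] with fixed direction, and then its direction is
    rotated. *)
Lemma contourP p p' : contour f p p' <-> coord1 (set_val p) = coord1 (set_val p') /\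
  forall t, between (coord2 (set_val p)) (coord2 (set_val p')) t ->
    c t <= coord1 (set_val p) <= c t + a.
Proof.
have Xp (s : X) : X (set_val s) by exact: set_valP.
split=> [pp'|[e1 st]].
  split; first by have /= := contour_val pp'.
  have ccp : connected ((coord2 \o set_val) @` contour f p).
    apply: connected_continuous_connected; first exact: component_connected.
    apply: continuous_subspaceT => s; apply: continuous_comp.
      exact: initial_continuous.
    exact: coord_continuous.
  have ip : ((coord2 \o set_val) @` contour f p) (coord2 (set_val p)).
    by exists p => //; exact: connected_component_refl.
  have ip' : ((coord2 \o set_val) @` contour f p) (coord2 (set_val p')).
    by exists p'.
  move=> t pt; have : ((coord2 \o set_val) @` contour f p) t.
    move/connected_intervalP: ccp => itv.
    by case: pt => pt; [exact: (itv _ _ ip ip')|exact: (itv _ _ ip' ip)].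
  move=> [s ps <-] /=; have /= <- := contour_val ps.
  exact: (hypersurface_strip a0 (Xp s)).
have [w w1 pw] := hypersurface_point hm a0 (Xp p).
have [w' w'1 pw'] := hypersurface_point hm a0 (Xp p').
set q := coord1 (set_val p) in e1 st pw; rewrite -e1 in pw'.
pose s := unit_point w1 q (coord2 (set_val p')).
have ps : contour f p s by exact: (contour_line w1 pw _ st).
apply: contour_trans ps _; apply: (contour_rotate _ w1 w'1 _ pw') => //.
by apply: st; rewrite /between; lra.
Qed.

End HypersurfaceContours.

(** * Critical points *)

Section Smooth.
Context {R : realType}.
Implicit Types (c f g : R -> R).

Lemma is_derive_derive1 f x df : is_derive x (1 : R) f df ->
  (f^`())%classic x = df.
Proof. by move=> [_ <-]; rewrite derive1E. Qed.

Lemma derivable_is_derive1 f x : derivable f x 1 ->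
  is_derive x (1 : R) f ((f^`())%classic x).
Proof. by move=> df; apply: DeriveDef => //; rewrite derive1E. Qed.

(** Meant for explicit families that are closed under derivation: affine functions, shifts of smooth
    functions, combinations of 1, [cos] and [sin]. *)
Lemma smooth_stable (P : set (R -> R)) :
  (forall f, P f -> (forall x, derivable f x 1) /\ P (f^`())%classic) ->
  forall f, P f -> smooth f.
Proof.
move=> stable f Pf n x; suff : P (f^`(n))%classic by move=> /stable[].
by elim: n => [|n IH]; [|rewrite derive1nS; have [] := stable _ IH].
Qed.

Lemma smooth_derivable f x : smooth f -> derivable f x 1.
Proof. by move=> sf; exact: (sf 0%N x). Qed.

Lemma smooth_derive1 f : smooth f -> smooth (f^`())%classic.
Proof.
by move=> sf n x; have := sf n.+1 x; rewrite /derive1n iterSr.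
Qed.

Lemma smooth_continuous f : smooth f -> continuous f.
Proof.
move=> sf x; apply: differentiable_continuous.
by apply/derivable1_diffP; exact: smooth_derivable.
Qed.

Lemma is_derive_affine (k l x : R) : is_derive x (1 : R) (fun t => k + l * t) l.
Proof.
have d : is_derive x (1 : R) (fun t => k + l * t) (0 + l *: 1).
  exact: (is_deriveD (is_derive_cst k x 1) (is_deriveZ l (is_derive_id x 1))).
by apply: (is_derive_eq d); rewrite add0r /GRing.scale /= mulr1.
Qed.

Lemma smooth_affine (k l : R) : smooth (fun t => k + l * t).
Proof.
pose P f := exists k l : R, f = fun t => k + l * t.
apply: (smooth_stable (P := P)); last by exists k, l.
move=> _ [k' [l' ->]]; split=> [x|].
  by have [] := is_derive_affine k' l' x.
exists l', 0; apply/funext => x; rewrite mul0r addr0.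
exact: (is_derive_derive1 (is_derive_affine k' l' x)).
Qed.

Lemma is_derive_shifted g (k e x : R) : derivable g (k + x) 1 ->
  is_derive x (1 : R) (fun t => g (k + t) + e) ((g^`())%classic (k + x)).
Proof.
move=> dg; have aff : is_derive x (1 : R) (fun t => k + t) 1.
  have := is_derive_affine k 1 x.
  rewrite (_ : (fun _ => _) = fun t => k + t) //.
  by apply/funext => t; rewrite mul1r.
have dcomp : is_derive x (1 : R) (g \o (fun t => k + t)) ((g^`())%classic (k + x)).
  apply: DeriveDef.
    apply/derivable1_diffP/differentiable_comp; apply/derivable1_diffP.
      by case: aff.
    exact: dg.
  have [daff _] := aff; rewrite -derive1E (derive1_comp daff dg).
  by rewrite (is_derive_derive1 aff) mulr1.
have d : is_derive x (1 : R) (fun t => g (k + t) + e)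
    ((g^`())%classic (k + x) + 0).
  exact: (is_deriveD dcomp (is_derive_cst e x 1)).
by apply: (is_derive_eq d); rewrite addr0.
Qed.

Lemma smooth_shifted g (k e : R) : smooth g -> smooth (fun t => g (k + t) + e).
Proof.
move=> sg; pose P f := exists g e, smooth g /\ f = fun t => g (k + t) + e.
apply: (smooth_stable (P := P)); last by exists g, e.
move=> _ [g' [e' [sg' ->]]]; split=> [x|].
  by have [] := @is_derive_shifted g' k e' x (smooth_derivable sg').
exists (g'^`())%classic, 0; split; first exact: smooth_derive1.
apply/funext => x; rewrite addr0.
exact: (is_derive_derive1 (@is_derive_shifted g' k e' x (smooth_derivable sg'))).
Qed.

Lemma is_derive_trig (k l n x : R) :
  is_derive x (1 : R) (fun t => k + l * cos t + n * sin t)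
    (n * cos x - l * sin x).
Proof.
have d : is_derive x (1 : R) (fun t => k + l * cos t + n * sin t)
    (0 + l *: (- sin x) + n *: cos x).
  exact: (is_deriveD (is_deriveD (is_derive_cst k x 1)
    (is_deriveZ l (is_derive_cos x))) (is_deriveZ n (is_derive_sin x))).
by apply: (is_derive_eq d); rewrite /GRing.scale /=; ring.
Qed.

Lemma smooth_trig (k l n : R) : smooth (fun t => k + l * cos t + n * sin t).
Proof.
pose P f := exists k l n : R, f = fun t => k + l * cos t + n * sin t.
apply: (smooth_stable (P := P)); last by exists k, l, n.
move=> _ [k' [l' [n' ->]]]; split=> [x|].
  by case: (is_derive_trig k' l' n' x).
exists 0, n', (- l'); apply/funext => x; rewrite add0r mulNr.
exact: (is_derive_derive1 (is_derive_trig k' l' n' x)).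
Qed.

Section CriticalSet.
Variable c : R -> R.
Hypothesis sc : smooth c.

Lemma critical_set_closed : closed (critical_set c).
Proof.
rewrite (_ : critical_set c = (c^`())%classic @^-1` [set 0]) //.
apply: preimage_closed; last exact: closed_eq.
by move=> x _; exact: (smooth_continuous (smooth_derive1 sc)).
Qed.

Lemma critical_set_const s s' : s <= s' ->
  (forall t, s <= t <= s' -> critical_set c t) -> c s = c s'.
Proof.
move=> ss' Sss'; have [lt|ge] := ltP s s'; last first.
  by have -> : s = s' by apply/le_anti; rewrite ss'.
have [|| t + e] := @MVT R c (c^`())%classic s s' lt.
- by move=> t _; exact/derivable_is_derive1/smooth_derivable.
- by apply: continuous_subspaceT; exact: smooth_continuous.
rewrite in_itv /= => tss'.
have ct : (c^`())%classic t = 0 by apply: Sss'; lra.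
by move: e; rewrite ct mul0r; lra.
Qed.

(** By the theorem of Rolle [c] is injective on the segment, and a continuous injective function is
    strictly monotone. *)
Lemma critical_set_mono x y : x < y ->
  (forall t, x < t < y -> ~ critical_set c t) ->
  (forall t u, x <= t -> t < u -> u <= y -> c t < c u) \/
  (forall t u, x <= t -> t < u -> u <= y -> c u < c t).
Proof.
move=> xy nS; have inj : {in `[x, y] &, injective c}.
  suff lt t u : t \in `[x, y] -> u \in `[x, y] -> t < u -> c t <> c u.
    by move=> t u xt xu ctu; case: (ltgtP t u) => // [tu|ut]; exfalso;
      [exact: lt tu ctu|exact: lt ut (esym ctu)].
  rewrite !in_itv /= => xt xu tu ctu.
  have [||v + dv] := @Rolle R c t u tu _ _ ctu.
  - by move=> v _; exact: smooth_derivable.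
  - by apply: continuous_subspaceT; exact: smooth_continuous.
  rewrite in_itv /= => tvu; apply: (nS v); first lra.
  exact: is_derive_derive1.
have cw : {within [set` `[x, y]], continuous c}.
  by apply: continuous_subspaceT; exact: smooth_continuous.
have [inc|dec] := itv_continuous_inj_mono cw inj; [left|right] => t u xt tu uy.
  by apply: inc => //; rewrite in_itv /=; lra.
by apply: dec => //; rewrite in_itv /=; lra.
Qed.

End CriticalSet.
End Smooth.

(** * Separation of the critical values *)

Section ConsecutivePieces.
Context {R : realType} (c : R -> R) (J : set int) (I : int -> set R).
Context (v : int -> R) (N a : R).
Hypotheses (hJ : index_range J)
  (hI : forall j, J j ->
    [/\ closed (I j), connected (I j), I j !=set0 & ts_piece (I j)])
  (hcons : consecutive J I) (hv : forall j, J j -> c @` I j = [set v j])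
  (hgap : forall j, J j -> J (j + 1) -> N < `|v j - v (j + 1)|) (aN : a < N).

Lemma index_range_between (j k : int) : J j -> J k -> j < k ->
  J (j + 1) /\ j + 1 <= k.
Proof.
move=> Jj Jk jk; have jk1 : j + 1 <= k by rewrite lezD1.
split => //; case: hJ Jj Jk => [[l l1 ->]|->|->] //=.
  move=> /andP[j1 _] /andP[_ kl]; apply/andP; split; last exact: le_trans kl.
  by rewrite (le_trans j1) // lerDl.
by move=> j1 _; rewrite (le_trans j1) // lerDl.
Qed.

(** If [s] and [s'] lie in different pieces, the interval between them meets two consecutive pieces,
    whose values differ by more than [N > a]. *)
Lemma pieces_gap s s' : (\bigcup_(j in J) I j) s -> (\bigcup_(j in J) I j) s' ->
  (forall t u, s <= t <= s' -> s <= u <= s' -> c t - c u <= a) ->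
  forall t, s <= t <= s' -> (\bigcup_(j in J) I j) t.
Proof.
move=> [j Jj js] [k Jk ks'] osc t /andP[st ts'].
have cv i x : J i -> I i x -> c x = v i.
  by move=> Ji ix; have : (c @` I i) (c x); [exists x|rewrite hv].
have far i x y : J i -> J (i + 1) -> I i x -> I (i + 1) y ->
    s <= x <= s' -> s <= y <= s' -> False.
  move=> Ji Ji1 ix iy sx sy; have := hgap Ji Ji1.
  rewrite -(cv _ _ Ji ix) -(cv _ _ Ji1 iy).
  have := osc _ _ sx sy; have := osc _ _ sy sx.
  by move=> h1 h2; apply/negP; rewrite -leNgt ler_norml; move: aN; lra.
have ss' := le_trans st ts'.
have [jk|kj|jk] := ltgtP j k; last 1 first.
- exists j => //; have [_ /connected_intervalP itv _ _] := hI Jj.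
  by apply: (itv s s'); rewrite ?st // jk.
- have [J1 jk1] := index_range_between Jj Jk jk.
  (* For [j < k] the listing must run from left to right because [s <= s']; for [k < j] it runs from
     right to left. *)
  case: hcons => ord; last first.
    by have := ord _ _ Jj Jk jk _ _ js ks'; rewrite ltNge ss'.
  have [y [y1 sy]] : exists y, I (j + 1) y /\ s <= y <= s'.
    move: jk1; rewrite le_eqVlt => /predU1P[e|jk1].
      by exists s'; rewrite e ss' lexx.
    have [_ _ [y y1] _] := hI J1; exists y; split => //.
    rewrite (ltW (ord _ _ J1 Jk jk1 _ _ y1 ks')) andbT.
    by apply/ltW/(ord j (j + 1)) => //; rewrite ltrDl.
  by exfalso; apply: (far j s y) => //; rewrite lexx.
- have [J1 jk1] := index_range_between Jk Jj kj.
  case: hcons => ord.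
    by have := ord _ _ Jk Jj kj _ _ ks' js; rewrite ltNge ss'.
  have [y [y1 sy]] : exists y, I (k + 1) y /\ s <= y <= s'.
    move: jk1; rewrite le_eqVlt => /predU1P[e|jk1].
      by exists s; rewrite e ss' lexx.
    have [_ _ [y y1] _] := hI J1; exists y; split => //.
    rewrite (ltW (ord _ _ J1 Jj jk1 _ _ y1 js)) /=.
    by apply/ltW/(ord k (k + 1)) => //; rewrite ltrDl.
  by exfalso; apply: (far k s' y) => //; rewrite lexx ss'.
Qed.

End ConsecutivePieces.

(** * Critical points of the first coordinate *)

Section CriticalPoints.
Context {R : realType} (m : nat) (c : R -> R) (a : R).
Hypotheses (hm : (2 <= m)%N) (sc : smooth c) (a0 : 0 < a).
Local Notation X := (hypersurface m c (fun x => c x + a)).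
Implicit Types (p v : 'rV[R]_m.+1).

Lemma diff_coord1 p v : 'd (@coord1 R m) p v = v ord0 ord0.
Proof.
have coord1_linear : linear (@coord1 R m : 'rV[R]_m.+1 -> R).
  by move=> k u w; rewrite /coord1 !mxE.
pose cM := GRing.isLinear.Build _ _ _ _ _ coord1_linear.
pose cL : {linear 'rV[R]_m.+1 -> R} := HB.pack (@coord1 R m) cM.
have -> : @coord1 R m = cL by [].
rewrite diff_lin //; exact: coord_continuous.
Qed.

(** Along a curve through [p] the distance to the boundary graph has an extremum at time 0. The
    velocity of the first coordinate therefore equals that of [c] along the curve, which
    vanishes. *)
Lemma boundary_critical p : X p -> critical_set c (coord2 p) ->
  coord1 p = c (coord2 p) \/ coord1 p = c (coord2 p) + a ->
  critical_on X coord1 p.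
Proof.
move=> Xp cp bp; split => // v [g [sg gX g0 gv]]; rewrite diff_coord1 -gv.
pose u t := g t ord0 ord0; pose y t := g t ord0 (inord 1).
have su : smooth u by exact: sg.
have sy : smooth y by exact: sg.
have dcy : is_derive (0 : R) (1 : R) (c \o y) 0.
  have dc : derivable c (y 0) 1 by exact: smooth_derivable.
  have dy : derivable y 0 1 by exact: smooth_derivable.
  apply: DeriveDef.
    by apply/derivable1_diffP/differentiable_comp; apply/derivable1_diffP.
  rewrite -derive1E (derive1_comp dy dc) (_ : (c^`())%classic (y 0) = 0) ?mul0r //.
  by rewrite /y g0; exact: cp.
have du : is_derive (0 : R) (1 : R) u ((u^`())%classic 0).
  exact/derivable_is_derive1/smooth_derivable.
have dcyt t : derivable (c \o y) t 1.
  apply/derivable1_diffP/differentiable_comp; apply/derivable1_diffP;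
  exact: smooth_derivable.
have strip t : c (y t) <= u t <= c (y t) + a.
  exact: (hypersurface_strip a0 (gX t)).
have [b0|b0] : u 0 = c (y 0) \/ u 0 = c (y 0) + a by rewrite /u /y g0.
  have dm : is_derive (0 : R) (1 : R) (u - (c \o y)) 0.
    apply: (@derive1_at_min _ _ (-1) 1); first lra.
    - by move=> t _; apply: derivableB => //; exact: smooth_derivable.
    - by rewrite in_itv /=; lra.
    - move=> t _; have := strip t.
      by rewrite -![(u - (c \o y)) _]/(u _ - c (y _)) b0; lra.
  have [_ e1] := is_deriveB du dcy; have [_ e2] := dm.
  by move: e1; rewrite e2 subr0.
have dm : is_derive (0 : R) (1 : R) (u - (c \o y)) 0.
  apply: (@derive1_at_max _ _ (-1) 1); first lra.
  - by move=> t _; apply: derivableB => //; exact: smooth_derivable.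
  - by rewrite in_itv /=; lra.
  - move=> t _; have := strip t.
    by rewrite -![(u - (c \o y)) _]/(u _ - c (y _)) b0; lra.
have [_ e1] := is_deriveB du dcy; have [_ e2] := dm.
by move: e1; rewrite e2 subr0.
Qed.

Lemma critical_tangent p (g : R -> 'rV[R]_m.+1) : critical_on X coord1 p ->
  (forall i, smooth (fun t => g t ord0 i)) -> (forall t, X (g t)) -> g 0 = p ->
  ((fun t => g t ord0 ord0)^`())%classic 0 = 0.
Proof.
move=> [Xp crit] sg gX g0.
pose v : 'rV[R]_m.+1 := \row_i ((fun t => g t ord0 i)^`())%classic 0.
have tv : tangent X p v.
  by exists g; split => // i; rewrite mxE.
by have := crit v tv; rewrite diff_coord1 mxE.
Qed.

(* A point off the boundary moves on the circle through it that is obtained by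
   fixing [x2] and the direction of [y]; a boundary point moves along the
   graph of [c] or [c + a]. *)
Lemma critical_boundary p : critical_on X coord1 p ->
  critical_set c (coord2 p) /\
  (coord1 p = c (coord2 p) \/ coord1 p = c (coord2 p) + a).
Proof.
move=> crit; have [Xp _] := crit.
have /hypersurfaceP[//|st e] := Xp.
set x1 := coord1 p in st e *; set x2 := coord2 p in st e *.
have inord1 : (inord 1 : 'I_m.+1) = 1%N :> nat.
  by rewrite inordK // ltnS (leq_trans _ hm).
have [bd|nbd] := eqVneq ((x1 - c x2) * (c x2 + a - x1)) 0; last first.
  exfalso; have [w w1 pw] := hypersurface_point hm a0 Xp.
  pose r := strip_radius c a x1 x2; pose al := x1 - c x2 - a / 2.
  have r2 : r ^+ 2 = (x1 - c x2) * (c x2 + a - x1).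
    by rewrite sqr_sqrtr // strip_ge0.
  have ral : al ^+ 2 + r ^+ 2 = a ^+ 2 / 4.
    by rewrite r2 /al; field.
  (* A circle of radius [a / 2] about the middle of the strip. Its first coordinate has velocity [r]
     at time 0, so criticality gives [r = 0], against [nbd]. *)
  pose g (t : R) : 'rV[R]_m.+1 := \row_(i < m.+1)
    if i == 0%N :> nat then (c x2 + a / 2) + al * cos t + r * sin t else
    if i == 1%N :> nat then x2 else 0 + (r * w i) * cos t + (- al * w i) * sin t.
  have := @critical_tangent p g crit.
  rewrite (_ : (fun t => g t ord0 ord0) =
    fun t => (c x2 + a / 2) + al * cos t + r * sin t); last first.
    by apply/funext => t; rewrite mxE.
  rewrite (is_derive_derive1 (is_derive_trig _ _ _ _)) cos0 sin0 mulr1 mulr0 subr0.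
  move=> tan0; suff r0 : r = 0 by move/eqP: nbd; apply; rewrite -r2 r0 expr0n.
  apply: tan0 => [i|t|].
  - rewrite (_ : (fun t => g t ord0 i) = if i == 0%N :> nat
      then (fun t => (c x2 + a / 2) + al * cos t + r * sin t)
      else if i == 1%N :> nat then (fun t => x2 + 0 * t)
      else fun t => 0 + (r * w i) * cos t + (- al * w i) * sin t); last first.
      apply/funext => t; rewrite mxE; case: ifP => // _; case: ifP => // _.
      by rewrite mul0r addr0.
    case: ifP => _; first exact: smooth_trig.
    by case: ifP => _; [exact: smooth_affine|exact: smooth_trig].
  - have g1 : coord1 (g t) = (c x2 + a / 2) + al * cos t + r * sin t.
      by rewrite /coord1 mxE.
    have g2 : coord2 (g t) = x2 by rewrite /coord2 mxE inord1.
    have gn : sqnorm (g t ord0) = (r * cos t - al * sin t) ^+ 2.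
      rewrite -[RHS]mulr1 -w1 -sqnormZ; apply: eq_bigr => i i2; rewrite mxE.
      by case: (i : nat) i2 => [|[|j]] // _; congr (_ ^+ 2); ring.
    have circle : (al * cos t + r * sin t) ^+ 2 + (r * cos t - al * sin t) ^+ 2 =
        a ^+ 2 / 4.
      by rewrite -ral -[RHS]mulr1 -(cos2Dsin2 t); ring.
    apply/hypersurfaceP => //; rewrite g1 g2 gn.
    set k := al * cos t + r * sin t in circle *.
    have -> : c x2 + a / 2 + al * cos t + r * sin t = c x2 + a / 2 + k.
      by rewrite /k addrA.
    have k2 : k ^+ 2 <= a ^+ 2 / 4 by rewrite -circle lerDl sqr_ge0.
    split; first by have := a0; nra.
    have -> : (r * cos t - al * sin t) ^+ 2 = a ^+ 2 / 4 - k ^+ 2.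
      by rewrite -circle addrAC subrr add0r.
    by field.
  - rewrite [RHS]pw; apply/rowP => i; rewrite !mxE clamp_id //.
    case: ifP => [_|_].
      by rewrite cos0 sin0 mulr1 mulr0 addr0 /al -/x1; field.
    by case: ifP => // _; rewrite cos0 sin0 mulr1 mulr0 addr0 add0r.
have bp : x1 = c x2 \/ x1 = c x2 + a.
  by move/eqP: bd; rewrite mulf_eq0 => /orP[]/eqP ?; [left|right]; lra.
split => //.
have y0 (i : 'I_m.+1) : (2 <= i)%N -> p ord0 i = 0.
  by apply: sqnorm_eq0; rewrite e bd.
(* As [k] is 0 or [a], the curve [g] follows a boundary graph; its first velocity is the derivative
   of [c] at [x2]. *)
pose k := x1 - c x2.
pose g (t : R) : 'rV[R]_m.+1 := \row_(i < m.+1)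
  if i == 0%N :> nat then c (x2 + t) + k else
  if i == 1%N :> nat then x2 + 1 * t else 0 + 0 * t.
have := @critical_tangent p g crit.
rewrite (_ : (fun t => g t ord0 ord0) = fun t => c (x2 + t) + k); last first.
  by apply/funext => t; rewrite mxE.
rewrite (is_derive_derive1 (is_derive_shifted _ (smooth_derivable sc))) addr0.
apply=> [i|t|].
- rewrite (_ : (fun t => g t ord0 i) = if i == 0%N :> nat
    then (fun t => c (x2 + t) + k) else if i == 1%N :> nat
    then (fun t => x2 + 1 * t) else fun t => 0 + 0 * t); last first.
    by apply/funext => t; rewrite mxE; case: ifP => // _; case: ifP.
  case: ifP => _; first exact: smooth_shifted.
  by case: ifP => _; exact: smooth_affine.
- have g1 : coord1 (g t) = c (x2 + t) + k by rewrite /coord1 mxE.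
  have g2 : coord2 (g t) = x2 + t by rewrite /coord2 mxE inord1 mul1r.
  have gn : sqnorm (g t ord0) = 0.
    apply: big1 => i i2; rewrite mxE.
    by case: (i : nat) i2 => [|[|j]] // _; rewrite mul0r addr0 expr0n.
  apply/hypersurfaceP => //; rewrite g1 g2 gn /k; have := a0.
  by case: bp => ->; split; [lra|ring|lra|ring].
- apply/rowP => i; rewrite mxE; have [i0|i0] := eqVneq (i : nat) 0%N.
    rewrite addr0 /k addrC subrK /x1 /coord1; congr (p _ _).
    by apply: val_inj.
  have [i1|i1] := eqVneq (i : nat) 1%N.
    rewrite mulr0 addr0 /x2 /coord2; congr (p _ _).
    by apply: val_inj; rewrite /= inord1.
  rewrite mul0r addr0 y0 //.
  by case: (i : nat) i0 i1 => [|[]].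
Qed.

End CriticalPoints.

(** * The Reeb space *)

Section ReebSpaceOfStrip.
Context {R : realType} (m : nat) (c : R -> R) (a : R).
Hypotheses (hm : (2 <= m)%N) (sc : smooth c) (a0 : 0 < a).
Hypothesis hline :
  m = 2%N -> ~ exists q, forall t, strip c (fun x => c x + a) (q, t).
Hypothesis critical_gap : forall s s', critical_set c s -> critical_set c s' ->
  (forall t u, s <= t <= s' -> s <= u <= s' -> c t - c u <= a) ->
  forall t, s <= t <= s' -> critical_set c t.
Local Notation X := (hypersurface m c (fun x => c x + a)).
Local Notation f := (sigL X coord1).
Local Notation crit := (set_val @^-1` critical_on X coord1 : set X).

Let cc : continuous c. Proof. exact: smooth_continuous. Qed.

(** With a fixed direction this is a continuous map from the plane that meets every contour, since a
    contour contains all directions over its points. *)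
Definition strip_lift (q x : R) : X := unit_point c hm a0 (sqnorm_axis2 hm) q x.

Definition reeb_lift (q x : R) : reeb_space f := reeb_map f (strip_lift q x).

Lemma reeb_map_lift (p : X) :
  reeb_map f p = reeb_lift (coord1 (set_val p)) (coord2 (set_val p)).
Proof.
have st := hypersurface_strip a0 (set_valP p).
apply/reeb_map_eqP/(contourP hm cc a0 hline).
rewrite coord1_strip_point coord2_strip_point // clamp_id //; split => // t.
move=> pt; have -> // : t = coord2 (set_val p).
by move: pt; rewrite /between; lra.
Qed.

Lemma reeb_fun_lift q x : reeb_fun f (reeb_lift q x) = clamp c a q x.
Proof. by rewrite /reeb_lift reeb_funE /= coord1_strip_point. Qed.

Lemma continuous_strip_lift :
  continuous (fun p : R * R => strip_lift p.1 p.2).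
Proof.
apply: (@continuous_comp_initial _ _ _ set_val).
rewrite (_ : _ \o _ = fun p : R * R => strip_point c a (@axis2 R m) p.1 p.2) //.
apply: (continuous_strip_point (a := a) cc (w := fun=> @axis2 R m)
  (f := fst) (g := snd)).
- by move=> i t; exact: cvg_cst.
- by move=> p; exact: cvg_fst.
- by move=> p; exact: cvg_snd.
Qed.

Lemma reeb_strip_quotient :
  strip_quotient c a (critical_set c) (reeb_fun f) reeb_lift.
Proof.
split.
- exact: cc.
- exact: a0.
- exact: critical_set_closed.
- exact: critical_gap.
- exact: critical_set_const.
- exact: critical_set_mono.
- apply/quotient_continuous; rewrite (_ : _ \o _ = f).
    move=> p; apply: continuous_comp; first exact: initial_continuous.
    exact: coord_continuous.
  by apply/funext => p; exact: (reeb_funE f p).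
- move=> p; apply: (@continuous_comp _ _ _ (fun p : R * R => strip_lift p.1 p.2)
    (reeb_map f)); first exact: continuous_strip_lift.
  exact: pi_continuous.
(* The quotient map is [reeb_lift] after the continuous map [k], so openness in the plane gives
   openness in [X] and hence in the quotient. *)
- move=> U oU; pose k (p : X) := (coord1 (set_val p), coord2 (set_val p)).
  have ck : continuous k.
    apply: continuous_pair => p; apply: continuous_comp;
    by [exact: initial_continuous|exact: coord_continuous].
  have : open (reeb_map f @^-1` U).
    rewrite (_ : _ @^-1` _ = k @^-1` [set p | U (reeb_lift p.1 p.2)]).
      by apply: open_comp => // p _; exact: ck.
    by apply/seteqP; split => p /=; rewrite reeb_map_lift.
  by [].
- move=> z; have <- : reeb_map f (repr z) = z by exact: reprK.
  exists (coord1 (set_val (repr z))), (coord2 (set_val (repr z))).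
  by rewrite -reeb_map_lift.
- by move=> q x st; rewrite reeb_fun_lift clamp_id.
- move=> q x; rewrite reeb_fun_lift; have st := clamp_strip c a0 q x.
  split => //; congr (reeb_map f _); apply: val_inj; apply/rowP => i.
  by rewrite !mxE (clamp_id st).
- move=> q x y xy qx qy; rewrite /reeb_lift; split.
    move=> /reeb_map_eqP/(contourP hm cc a0 hline)[_].
    rewrite !coord1_strip_point !coord2_strip_point // clamp_id // => st t xt.
    by apply: st; left.
  move=> st; apply/reeb_map_eqP/(contourP hm cc a0 hline).
  rewrite !coord1_strip_point !coord2_strip_point // !clamp_id //; split => //.
  move=> t [|yt]; first exact: st.
  by apply: st; lra.
Qed.

Lemma reeb_vertices_strip : reeb_vertices f crit =
  strip_vertices c a (critical_set c) (reeb_fun f) reeb_lift.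
Proof.
apply/seteqP; split=> [_ [p cp <-]|z [s [cs [st zs] hz]]].
  have [cs bp] := critical_boundary hm sc a0 cp.
  exists (coord2 (set_val p)); split => //.
    rewrite reeb_map_lift; apply: (levels_tau reeb_strip_quotient).
    exact: (hypersurface_strip a0 (set_valP p)).
  by rewrite reeb_funE.
exists (strip_lift (reeb_fun f z) s); last exact: zs.
have Xp := set_valP (strip_lift (reeb_fun f z) s).
apply: (boundary_critical sc a0 Xp).
- by rewrite coord2_strip_point.
- by rewrite coord1_strip_point coord2_strip_point // clamp_id.
Qed.

End ReebSpaceOfStrip.

Theorem theorem2 (R : realType) (m : nat) (c1 c2 : R -> R)
    (J : set int) (I : int -> set R) (v : int -> R) (N a : R)
    (hm : (2 <= m)%N)
    (hc1 : ts_function c1)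
    (hS : critical_set c1 !=set0)
    (hJ : index_range J)
    (hSI : critical_set c1 = \bigcup_(j in J) I j)
    (hdisj : trivIset J I)
    (hI : forall j, J j ->
      [/\ closed (I j), connected (I j), I j !=set0 & ts_piece (I j)])
    (hcons : consecutive J I)
    (hv : forall j, J j -> c1 @` I j = [set v j])
    (hN : 0 < N)
    (hgap : forall j, J j -> J (j + 1) -> N < `|v j - v (j + 1)|)
    (ha : 0 < a < N)
    (hc2 : c2 = (fun x => c1 x + a))
    (* Only for m = 2, where the claim is false without it: no line
       {q} x R lies inside the strip. Automatic when J has two elements. *)
    (hline : m = 2%N -> ~ exists q, forall t, strip c1 c2 (q, t)) :
  let X := hypersurface m c1 c2 in
  let f := sigL X coord1 in
  let crit := set_val @^-1` critical_on X coord1 in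
  exists E : set (set (reeb_space f)),
    [/\ is_reeb_graph f crit E,
        forall z, reeb_vertices f crit z ->
          [\/ has_degree E z 1, has_degree E z 2 | has_degree E z 3],
        is_reeb_digraph f crit E &
        forall z, reeb_vertices f crit z -> local_extremum (reeb_fun f) z ->
          has_degree E z 1].
Proof.
move: hline; rewrite hc2 => hline X f crit.
have [sc _] := hc1; have /andP[a0 aN] := ha.
(* The separation of consecutive critical values is put into the form of [sq_gap]. *)
have gap s s' : critical_set c1 s -> critical_set c1 s' ->
    (forall t u, s <= t <= s' -> s <= u <= s' -> c1 t - c1 u <= a) ->
    forall t, s <= t <= s' -> critical_set c1 t.
  by rewrite hSI; exact: (pieces_gap hJ hI hcons hv hgap aN).
have H := reeb_strip_quotient hm sc a0 hline gap.
have VE := reeb_vertices_strip hm sc a0 hline gap.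
exists (strip_edges c1 a (critical_set c1) (reeb_fun f) (reeb_lift c1 hm a0)).
rewrite /is_reeb_digraph /is_reeb_graph VE; split.
- exact: (strip_graph H hS).
- exact: (strip_degree H).
- by split; [exact: (strip_graph H hS)|exact: (strip_oriented H hS)].
- exact: (strip_extremum H).
Qed.
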